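(* For $(\lambda,r),(\mu,s)\in\Lambda$ we have $$\operatorname{Ext}^1_{\mathcal G}(V(\lambda,r),V(\mu,s))=0\quad\text{if } s\ne r+1,$$ $$\operatorname{Ext}^1_{\mathcal G}(V(\lambda,r),V(\mu,r+1))\cong\operatorname{Hom}_{\mathfrak g}(V(\lambda),\mathfrak g\otimes V(\mu)).$$ In other words, $\operatorname{Ext}^1_{\mathcal G}(V(\lambda,r),V(\mu,s))=0$ unless $(\mu,s)$ covers $(\lambda,r)$.
   Context: Let $\mathfrak g$ be a finite-dimensional complex simple Lie algebra with Cartan subalgebra $\mathfrak h$, root system $R$, dominant integral weights $P^+$, and simple finite-dimensional modules $V(\lambda)$, $\lambda\in P^+$; $\mathfrak g$ is regarded as the adjoint module. $\mathbb Z_+$ denotes the nonnegative integers. Let $\mathfrak g[t]=\mathfrak g\otimes\mathbb C[t]$, graded by powers of $t$. $\mathcal G$ is the category of $\mathbb Z_+$-graded $\mathfrak g[t]$-modules $V=\bigoplus_{r\in\mathbb Z_+}V[r]$ with all $V[r]$ finite-dimensional, $V[r]=0$ for all sufficiently large $r$, and $(xt^k)V[r]\subset V[r+k]$; morphisms are degree-preserving $\mathfrak g[t]$-module maps. For $(\lambda,r)\in\Lambda:=P^+\times\mathbb Z_+$, $V(\lambda,r)$ is $V(\lambda)$ placed in degree $r$ with $xt^k$ acting as $\delta_{k,0}x$. Say $(\mu,s)\in\Lambda$ covers $(\lambda,r)\in\Lambda$ if $s=r+1$ and $\mu-\lambda\in R\sqcup\{0\}$. *)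

(* Defs.v *)
From HB Require Import structures.
From mathcomp Require Import all_boot all_order all_algebra.
From mathcomp Require Import complex.
From mathcomp Require Import boolp functions reals.

Set Implicit Arguments.
Unset Strict Implicit.
Unset Printing Implicit Defensive.

Import GRing.Theory Num.Theory VectorInternalTheory.
Local Open Scope ring_scope.

HB.mixin Record isLieAlgebra (K : fieldType) L of GRing.Lmodule K L := {
  lie : L -> L -> L;
  lie_linearl : forall y, linear (lie^~ y);
  lie_linearr : forall x, linear (lie x);
  liexx : forall x, lie x x = 0;
  lie_jacobi : forall x y z,
    lie x (lie y z) + lie y (lie z x) + lie z (lie x y) = 0 }.

#[short(type="lieAlgType")]
HB.structure Definition LieAlgebra (K : fieldType) :=
  {L of GRing.Lmodule K L & isLieAlgebra K L}.

#[short(type="vectLieAlgType")]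
HB.structure Definition VectLieAlgebra (K : fieldType) :=
  {L of Vector K L & isLieAlgebra K L}.

HB.instance Definition _ (K : fieldType) (L : lieAlgType K) (x : L) :=
  GRing.isLinear.Build K L L _ (lie x) (lie_linearr x).

Section LieTheory.
Variables (K : fieldType) (L : lieAlgType K).
Implicit Types x y z : L.

Lemma lieDl x1 x2 y : lie (x1 + x2) y = lie x1 y + lie x2 y.
Proof. by have := lie_linearl y 1 x1 x2; rewrite !scale1r. Qed.

Lemma lie0l y : lie 0 y = 0.
Proof. by apply: (addIr (lie 0 y)); rewrite -lieDl !add0r. Qed.

Lemma lieZl a x y : lie (a *: x) y = a *: lie x y.
Proof. by have := lie_linearl y a x 0; rewrite lie0l !addr0. Qed.

Lemma lie_skew x y : lie x y = - lie y x.
Proof.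
apply/eqP; rewrite -addr_eq0; apply/eqP.
by have := liexx (x + y); rewrite lieDl !linearD /= !liexx add0r addr0.
Qed.

Lemma lie_suml I r (P : pred I) (F : I -> L) y :
  lie (\sum_(i <- r | P i) F i) y = \sum_(i <- r | P i) lie (F i) y.
Proof. by apply: (big_morph (lie^~ y)) => [u v|]; rewrite ?lieDl ?lie0l. Qed.

End LieTheory.

(* The current algebra g[t]: a polynomial \sum_k x_k t^k is stored as its      *)
(* coefficient sequence k |-> x_k, which has finite support.                   *)
Section Current.
Variables (K : numFieldType) (g : lieAlgType K).

Definition finsupp_seq : pred (nat -> g) :=
  fun f => `[< exists N : nat, forall n, (N <= n)%N -> f n = 0 >].

Lemma finsupp_seq_submod : submod_closed finsupp_seq.
Proof.
split; first by apply/asboolP; exists 0%N.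
move=> a u v /asboolP[N uN] /asboolP[M vM]; apply/asboolP; exists (maxn N M).
move=> n; rewrite geq_max => /andP[Nn Mn].
by change (a *: u n + v n = 0); rewrite uN// vM// scaler0 addr0.
Qed.

HB.instance Definition _ :=
  GRing.isSubmodClosed.Build K (nat -> g) finsupp_seq finsupp_seq_submod.

Record current := Current {
  coeft :> nat -> g;
  coeftP : finsupp_seq coeft }.

HB.instance Definition _ := [isSub for coeft].
HB.instance Definition _ := [Choice of current by <:].
HB.instance Definition _ := [SubChoice_isSubLmodule of current by <:].

Lemma current_eqP (a b : current) : (forall n, a n = b n) -> a = b.
Proof. by move=> ab; apply: val_inj; apply/funext. Qed.

Lemma coeftD (a b : current) n : (a + b) n = a n + b n. Proof. by []. Qed.
Lemma coeftZ c (a : current) n : (c *: a) n = c *: a n. Proof. by []. Qed.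
Lemma coeft0 n : (0 : current) n = 0. Proof. by []. Qed.

Definition current_lie_fun (a b : nat -> g) : nat -> g :=
  fun n => \sum_(i < n.+1) lie (a i) (b (n - i)%N).

Lemma current_lie_subproof (a b : current) :
  finsupp_seq (current_lie_fun a b).
Proof.
have /asboolP[N aN] := coeftP a; have /asboolP[M bM] := coeftP b.
apply/asboolP; exists (N + M)%N => n NMn; apply: big1 => i _.
have [Ni|iN] := leqP N i; first by rewrite aN// lie0l.
rewrite bM ?linear0// leq_subRL; last by rewrite -ltnS.
by apply: leq_trans NMn; rewrite leq_add2r ltnW.
Qed.

Definition current_lie (a b : current) : current :=
  Current (current_lie_subproof a b).

Lemma current_lieE (a b : current) n :
  current_lie a b n = \sum_(i < n.+1) lie (a i) (b (n - i)%N).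
Proof. by []. Qed.

Lemma current_lie_linearl b : linear (current_lie^~ b).
Proof.
move=> c a a'; apply: current_eqP => n.
rewrite coeftD coeftZ !current_lieE scaler_sumr -big_split /=.
by apply: eq_bigr => i _; exact: lie_linearl.
Qed.

Lemma current_lie_linearr a : linear (current_lie a).
Proof.
move=> c b b'; apply: current_eqP => n.
rewrite coeftD coeftZ !current_lieE scaler_sumr -big_split /=.
by apply: eq_bigr => i _; exact: lie_linearr.
Qed.

Lemma current_liexx a : current_lie a a = 0.
Proof.
apply: current_eqP => n; rewrite coeft0.
have E : current_lie a a n = - current_lie a a n.
  rewrite {1}current_lieE (reindex_inj rev_ord_inj) current_lieE /= -sumrN.
  apply: eq_bigr => i _; rewrite lie_skew subSS subKn //.
  by rewrite -ltnS.
have /eqP : (2%:R : K) *: current_lie a a n = 0.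
  by rewrite scaler_nat mulr2n {1}E addNr.
by rewrite scaler_eq0 pnatr_eq0 /= => /eqP.
Qed.

Lemma triple_sumE n (F : nat -> nat -> nat -> g) :
  \sum_(i < n.+1) \sum_(j < (n - i).+1) F i j (n - i - j)%N =
  \sum_(i < n.+1) \sum_(j < n.+1) \sum_(k < n.+1 | (i + j + k == n)%N) F i j k.
Proof.
apply: eq_bigr => i _.
have le_in : (i <= n)%N by rewrite -ltnS.
rewrite -(big_mkord xpredT (fun j => F i j (n - i - j)%N)).
rewrite (big_nat_widen _ _ n.+1); last by rewrite ltnS leq_subr.
rewrite big_mkord big_mkcond /=; apply: eq_bigr => j _.
rewrite ltnS; case: ifP => [jni|/negbT jni].
  have ijn : (i + j <= n)%N by rewrite -leq_subRL.
  have kn : (n - i - j < n.+1)%N by rewrite ltnS -subnDA leq_subr.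
  rewrite (big_pred1 (Ordinal kn)) // => k /=.
  rewrite -val_eqE /= -subnDA -(eqn_add2l (i + j)%N k) subnKC //.
rewrite big_pred0// => k; apply/negbTE; apply: contraNN jni => /eqP ijk.
by rewrite leq_subRL// -[X in (_ <= X)%N]ijk leq_addr.
Qed.

Lemma current_lie2E a b c n :
  current_lie a (current_lie b c) n =
  \sum_(i < n.+1) \sum_(j < n.+1) \sum_(k < n.+1 | (i + j + k == n)%N)
    lie (a i) (lie (b j) (c k)).
Proof.
rewrite -(triple_sumE n (fun i j k => lie (a i) (lie (b j) (c k)))).
by rewrite current_lieE; apply: eq_bigr => i _; rewrite current_lieE linear_sum.
Qed.

Lemma current_lie_jacobi a b c :
  current_lie a (current_lie b c) + current_lie b (current_lie c a) +
  current_lie c (current_lie a b) = 0.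
Proof.
apply: current_eqP => n; rewrite !coeftD coeft0 !current_lie2E.
rewrite [X in _ + X + _](_ : _ = \sum_(i < n.+1) \sum_(j < n.+1)
  \sum_(k < n.+1 | (i + j + k == n)%N) lie (b j) (lie (c k) (a i))); last first.
  under eq_bigr do under eq_bigr do rewrite big_mkcond.
  under [RHS]eq_bigr do under eq_bigr do rewrite big_mkcond.
  under eq_bigr do rewrite exchange_big.
  rewrite exchange_big /=; apply: eq_bigr => i _; apply: eq_bigr => j _.
  by apply: eq_bigr => k _; rewrite [in LHS]addnC addnA.
rewrite [X in _ + X](_ : _ = \sum_(i < n.+1) \sum_(j < n.+1)
  \sum_(k < n.+1 | (i + j + k == n)%N) lie (c k) (lie (a i) (b j))); last first.
  under eq_bigr do under eq_bigr do rewrite big_mkcond.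
  under [RHS]eq_bigr do under eq_bigr do rewrite big_mkcond.
  rewrite exchange_big /=; apply: eq_bigr => i _.
  rewrite exchange_big /=; apply: eq_bigr => j _.
  by apply: eq_bigr => k _; rewrite -addnA addnC.
rewrite -!big_split big1//= => i _; rewrite -!big_split big1//= => j _.
by rewrite -!big_split big1//= => k _; apply: lie_jacobi.
Qed.

HB.instance Definition _ := isLieAlgebra.Build K current
  current_lie_linearl current_lie_linearr current_liexx current_lie_jacobi.

Lemma tmon_subproof x k : finsupp_seq (fun n => if n == k then x else 0).
Proof.
by apply/asboolP; exists k.+1 => n kn; rewrite gtn_eqF.
Qed.

(* The element x t^k. *)
Definition tmon (x : g) (k : nat) : current := Current (tmon_subproof x k).

End Current.

(* Finite-dimensional modules over a (possibly infinite-dimensional) L. *)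
Record lieModule (K : fieldType) (L : lieAlgType K) := LieModule {
  lmod_sort :> vectType K;
  act : L -> lmod_sort -> lmod_sort;
  act_linearl : forall v, linear (act^~ v);
  act_linearr : forall x, linear (act x);
  act_lie : forall x y v, act (lie x y) v = act x (act y v) - act y (act x v) }.
Arguments act {K L l} x v.

HB.instance Definition _ (K : fieldType) (L : lieAlgType K) (V : lieModule L)
    (x : L) :=
  GRing.isLinear.Build K V V _ (act x) (act_linearr x).

Lemma act0l (K : fieldType) (L : lieAlgType K) (V : lieModule L) (v : V) :
  act 0 v = 0.
Proof.
have := act_linearl v (-1) 0 0.
by rewrite scaler0 addr0 scaleN1r addNr.
Qed.

Definition is_lmod_hom (K : fieldType) (L : lieAlgType K) (V W : lieModule L)
    (f : 'Hom(V, W)) : Prop :=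
  forall x v, f (act x v) = act x (f v).

Section LieHom.
Variables (K : fieldType) (L : lieAlgType K) (V W : lieModule L).

Definition lmod_hom_pred : pred 'Hom(V, W) := fun f => `[< is_lmod_hom f >].

Lemma lmod_hom_submod : submod_closed lmod_hom_pred.
Proof.
split; first by apply/asboolP => x v; rewrite !lfunE linear0.
move=> a f h /asboolP fP /asboolP hP; apply/asboolP => x v.
by rewrite !lfunE /= !lfunE /= linearP fP hP.
Qed.

HB.instance Definition _ :=
  GRing.isSubmodClosed.Build K 'Hom(V, W) lmod_hom_pred lmod_hom_submod.

Record lieHom := LieHom {
  lieHom_val :> 'Hom(V, W);
  lieHomP : lmod_hom_pred lieHom_val }.

HB.instance Definition _ := [isSub for lieHom_val].
HB.instance Definition _ := [Choice of lieHom by <:].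
HB.instance Definition _ := [SubChoice_isSubLmodule of lieHom by <:].

End LieHom.

Section Adjoint.
Variables (K : fieldType) (g : vectLieAlgType K).

Lemma adjoint_lie (x y v : g) :
  lie (lie x y) v = lie x (lie y v) - lie y (lie x v).
Proof.
have /eqP := lie_jacobi x y v.
by rewrite (lie_skew v x) (lie_skew v) linearN subr_eq0 => /eqP.
Qed.

Definition adjoint : lieModule g :=
  LieModule (@lie_linearl K g) (@lie_linearr K g) adjoint_lie.

End Adjoint.

(* U (x) V is realised on matrices through the coordinates v2r of the          *)
(* vectTypes U and V: the pure tensor u (x) v is the rank-one matrix           *)
(* (v2r u)^T *m v2r v (see tensor_actE and tensor_universal).                  *)
Section Tensor.
Variables (K : fieldType) (L : lieAlgType K) (U V : lieModule L).

Definition tens (u : U) (v : V) : 'M[K]_(dim U, dim V) :=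
  (v2r u)^T *m v2r v.

Definition act_mx (W : lieModule L) (x : L) : 'M[K]_(dim W) :=
  lin1_mx (v2r \o act x \o r2v).

Lemma act_mxE (W : lieModule L) x (w : W) : v2r w *m act_mx W x = v2r (act x w).
Proof. by rewrite mul_rV_lin1 /= v2rK. Qed.

Lemma act_mxP (W : lieModule L) a x y : act_mx W (a *: x + y) = a *: act_mx W x + act_mx W y.
Proof.
apply/row_matrixP => i; rewrite linearP /= !rowE.
rewrite -[delta_mx _ _]r2vK !act_mxE.
by have /= -> := act_linearl (r2v (delta_mx 0 i) : W) a x y; rewrite linearP.
Qed.

Lemma act_mx_lie (W : lieModule L) x y :
  act_mx W (lie x y) = act_mx W y *m act_mx W x - act_mx W x *m act_mx W y.
Proof.
apply/row_matrixP => i; rewrite linearB /= !rowE !mulmxA.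
rewrite -[delta_mx _ _]r2vK !act_mxE.
by rewrite act_lie linearB.
Qed.

Definition tensor_act (x : L) (M : 'M[K]_(dim U, dim V)) :
    'M[K]_(dim U, dim V) :=
  (act_mx U x)^T *m M + M *m act_mx V x.

Lemma tensor_act_linearl M : linear (tensor_act^~ M).
Proof.
move=> a x y; rewrite /tensor_act !act_mxP linearP /= mulmxDl mulmxDr.
by rewrite -scalemxAl -scalemxAr scalerDr addrACA.
Qed.

Lemma tensor_act_linearr x : linear (tensor_act x).
Proof.
move=> a M N; rewrite /tensor_act mulmxDl mulmxDr.
by rewrite -scalemxAl -scalemxAr scalerDr addrACA.
Qed.

Lemma tensor_act_lie x y M :
  tensor_act (lie x y) M =
  tensor_act x (tensor_act y M) - tensor_act y (tensor_act x M).
Proof.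
rewrite /tensor_act !act_mx_lie linearB /= !trmx_mul mulmxBl mulmxBr.
have AC (Z : zmodType) (a b c d e f : Z) :
    (a - b) + (c - d) = (a + e) + (f + c) - ((b + f) + (e + d)).
  rewrite (addrC f) [a + e + _]addrACA (addrC b) [f + b + _]addrACA.
  by rewrite (addrC f) addrKA opprD addrACA.
by rewrite !mulmxDl !mulmxDr !mulmxA; apply: AC.
Qed.

Definition tensor : lieModule L :=
  LieModule tensor_act_linearl tensor_act_linearr tensor_act_lie.

Lemma tensor_actE x u v :
  (act x (tens u v : tensor)) = tens (act x u) v + tens u (act x v).
Proof.
rewrite /= /tensor_act /tens -!act_mxE trmx_mul.
by rewrite !mulmxA.
Qed.

Lemma tens_linearl v : linear (tens^~ v).
Proof. by move=> a u u'; rewrite /tens !linearP /= mulmxDl -scalemxAl. Qed.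

Lemma tens_linearr u : linear (tens u).
Proof. by move=> a v v'; rewrite /tens linearP /= mulmxDr -scalemxAr. Qed.

Lemma tens_delta i j :
  tens (r2v (delta_mx 0 i)) (r2v (delta_mx 0 j)) = delta_mx i j.
Proof. by rewrite /tens !r2vK trmx_delta mul_delta_mx. Qed.

Lemma tensor_universal (X : lmodType K) (b : U -> V -> X) :
  (forall v, linear (b^~ v)) -> (forall u, linear (b u)) ->
  exists f : 'M[K]_(dim U, dim V) -> X,
    [/\ linear f, forall u v, f (tens u v) = b u v &
      forall f' : 'M[K]_(dim U, dim V) -> X, linear f' ->
        (forall u v, f' (tens u v) = b u v) -> f' =1 f].
Proof.
move=> bl br.
have sumE (f : 'M[K]_(dim U, dim V) -> X) : linear f -> forall M,
    f M = \sum_i \sum_j M i j *: f (delta_mx i j).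
  move=> fl M; pose F : {linear 'M[K]_(dim U, dim V) -> X} :=
    HB.pack f (GRing.isLinear.Build K _ X _ f fl).
  rewrite -[f]/(F : _ -> _) {1}[M]matrix_sum_delta linear_sum.
  apply: eq_bigr => i _; rewrite linear_sum; apply: eq_bigr => j _.
  by rewrite linearZ.
pose f (M : 'M[K]_(dim U, dim V)) : X :=
    \sum_i \sum_j M i j *: b (r2v (delta_mx 0 i)) (r2v (delta_mx 0 j)).
have fl : linear f.
  move=> a M N; rewrite /f scaler_sumr -big_split; apply: eq_bigr => i _ /=.
  rewrite scaler_sumr -big_split; apply: eq_bigr => j _ /=.
  by rewrite !mxE scalerDl scalerA.
exists f; split=> // [u v|f' f'l f'E M]; last first.
  rewrite (sumE _ f'l); apply: eq_bigr => i _; apply: eq_bigr => j _.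
  by rewrite -tens_delta f'E.
have lsum (W : vectType K) (h : W -> X) : linear h -> forall w,
    h w = \sum_i v2r w 0 i *: h (r2v (delta_mx 0 i)).
  move=> hl w; pose H : {linear W -> X} :=
    HB.pack h (GRing.isLinear.Build K W X _ h hl).
  rewrite -[h]/(H : _ -> _) -{1}[w]v2rK [v2r w in LHS]row_sum_delta.
  by rewrite !linear_sum; apply: eq_bigr => i _; rewrite !linearZ.
rewrite [RHS](lsum _ _ (bl v)); apply: eq_bigr => i _.
rewrite [b _ v](lsum _ _ (br _)) scaler_sumr; apply: eq_bigr => j _.
by rewrite scalerA /tens !mxE big_ord1 !mxE.
Qed.

End Tensor.

Section Roots.
Variables (K : fieldType) (g : vectLieAlgType K).

Definition lie_ideal (I : {vspace g}) : Prop :=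
  forall x y, y \in I -> lie x y \in I.

Definition lie_simple : Prop :=
  (exists x y : g, lie x y != 0) /\
  (forall I : {vspace g}, lie_ideal I -> I = 0%VS \/ I = fullv).

Definition ad_diagonalizable (x : g) : Prop :=
  exists2 b : seq g, basis_of fullv b &
    forall v, v \in b -> exists a : K, lie x v = a *: v.

(* The usual definition for a complex semisimple g: an abelian, self-          *)
(* centralizing subalgebra all of whose elements are ad-diagonalizable.        *)
Definition cartan_subalgebra (h : {vspace g}) : Prop :=
  [/\ forall x y, x \in h -> y \in h -> lie x y = 0,
      forall x, (forall y, y \in h -> lie y x = 0) -> x \in h &
      forall x, x \in h -> ad_diagonalizable x].

Variable h : {vspace g}.

(* The dual space h^*. *)
Definition weight := 'Hom(subvs_of h, K^o).

Definition in_root_space (a : weight) (x : g) : Prop :=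
  forall t : subvs_of h, lie (vsval t) x = (a t : K) *: x.

Definition is_root (a : weight) : Prop :=
  a != 0 /\ exists2 x : g, x != 0 & in_root_space a x.

Definition nonneg_comb (D : seq weight) (a : weight) : Prop :=
  exists n : 'I_(size D) -> nat, a = \sum_(i < size D) D`_i *+ n i.

(* D is a set of simple roots: a basis of h^* made of roots such that every    *)
(* root is a nonnegative or a nonpositive integral combination of D.           *)
Definition is_root_base (D : seq weight) : Prop :=
  [/\ basis_of fullv D,
      forall a, a \in D -> is_root a &
      forall a, is_root a -> nonneg_comb D a \/ nonneg_comb D (- a)].

Definition positive_root (D : seq weight) (a : weight) : Prop :=
  is_root a /\ nonneg_comb D a.

(* t is the coroot of a: the element of [g_a, g_{-a}] with a(t) = 2. *)
Definition is_coroot (a : weight) (t : subvs_of h) : Prop :=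
  (exists x y, [/\ in_root_space a x, in_root_space (- a) y &
                   vsval t = lie x y]) /\
  a t = 2%:R.

Definition dominant_integral (D : seq weight) (l : weight) : Prop :=
  forall a t, a \in D -> is_coroot a t -> exists n : nat, l t = n%:R.

Definition submodule (V : lieModule g) (U : {vspace V}) : Prop :=
  forall x v, v \in U -> act x v \in U.

Definition simple_module (V : lieModule g) : Prop :=
  (fullv : {vspace V}) <> 0%VS /\
  (forall U : {vspace V}, submodule U -> U = 0%VS \/ U = fullv).

Definition highest_weight_vector (D : seq weight) (l : weight)
    (V : lieModule g) (v : V) : Prop :=
  [/\ v != 0,
      forall t : subvs_of h, act (vsval t) v = l t *: v &
      forall a x, positive_root D a -> in_root_space a x -> act x v = 0].

(* V is a model of V(l). *)
Definition is_simple_hw (D : seq weight) (l : weight) (V : lieModule g) : Prop :=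
  simple_module V /\ exists v : V, highest_weight_vector D l v.

Definition covers (ms lr : weight * nat) : Prop :=
  ms.2 = lr.2.+1 /\ (is_root (ms.1 - lr.1) \/ ms.1 - lr.1 = 0).

End Roots.

(* The category G.  An object V = \bigoplus_r V[r] with all V[r] finite-       *)
(* dimensional and V[r] = 0 for r large is itself finite-dimensional, so its   *)
(* carrier is a vectType.                                                      *)
Section CategoryG.
Variables (K : numFieldType) (g : lieAlgType K).

Record grModule := GrModule {
  gr_mod :> lieModule (current g);
  deg : nat -> {vspace gr_mod};
  deg_sum : exists N : nat,
    [/\ forall r, (N <= r)%N -> deg r = 0%VS,
        directv (\sum_(r < N) deg r) &
        (\sum_(r < N) deg r)%VS = fullv];
  deg_act : forall (x : g) k r v,
    v \in deg r -> act (tmon x k) v \in deg (r + k) }.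

Definition is_gr_hom (V W : grModule) (f : 'Hom(V, W)) : Prop :=
  is_lmod_hom f /\ forall r v, v \in deg V r -> f v \in deg W r.

(* For a g-module V and r >= 0, the object V(., r) of G. *)
Section Eval.
Variables (V : lieModule g) (r : nat).

Definition ev_act (a : current g) (v : V) : V := act (coeft a 0) v.

Lemma ev_act_linearl v : linear (ev_act^~ v).
Proof. by move=> c a b; exact: act_linearl. Qed.

Lemma ev_act_linearr a : linear (ev_act a).
Proof. exact: act_linearr. Qed.

Lemma ev_act_lie a b v :
  ev_act (lie a b) v = ev_act a (ev_act b v) - ev_act b (ev_act a v).
Proof. by rewrite -act_lie /ev_act [lie a b 0%N]big_ord1. Qed.

Definition ev_lmod : lieModule (current g) :=
  LieModule ev_act_linearl ev_act_linearr ev_act_lie.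

Definition ev_deg (s : nat) : {vspace ev_lmod} :=
  if s == r then fullv else 0%VS.

Lemma ev_deg_sum : exists N : nat,
  [/\ forall s, (N <= s)%N -> ev_deg s = 0%VS,
      directv (\sum_(s < N) ev_deg s) &
      (\sum_(s < N) ev_deg s)%VS = fullv].
Proof.
exists r.+1; rewrite /ev_deg.
have E : (\sum_(s < r.+1) ev_deg s)%VS = fullv.
  rewrite (bigD1 ord_max)//= /ev_deg eqxx big1 ?addv0// => i.
  by rewrite -val_eqE /= => /negbTE ->.
split=> [s rs||//]; first by rewrite gtn_eqF.
rewrite directvE /= E (bigD1 ord_max)//= eqxx big1 ?addn0// => i.
by rewrite -val_eqE /= => /negbTE ->; rewrite dimv0.
Qed.

Lemma ev_deg_act (x : g) k s (v : ev_lmod) :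
  v \in ev_deg s -> act (tmon x k) v \in ev_deg (s + k).
Proof.
case: k => [|k]; last first.
  by move=> _; rewrite [act _ _](_ : _ = 0) ?mem0v//; exact: (act0l (v : V)).
rewrite /ev_deg addn0; case: ifP; rewrite ?memvf// !memv0 => _ /eqP ->.
by rewrite linear0.
Qed.

Definition ev_gr : grModule := GrModule ev_deg_sum ev_deg_act.

End Eval.

(* Ext^1_G(A, B) is the set of classes of extensions 0 -> B -> E -> A -> 0 in  *)
(* G, with its Baer vector space structure.                                    *)
Section Ext.
Variables A B : grModule.

Record extension := Extension {
  ext_mid :> grModule;
  ext_inc : 'Hom(B, ext_mid);
  ext_prj : 'Hom(ext_mid, A);
  ext_inc_hom : is_gr_hom ext_inc;
  ext_prj_hom : is_gr_hom ext_prj;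
  ext_inj : lker ext_inc = 0%VS;
  ext_exact : limg ext_inc = lker ext_prj;
  ext_surj : limg ext_prj = fullv }.

(* By the five lemma such a phi is an isomorphism. *)
Definition ext_equiv (E F : extension) : Prop :=
  exists phi : 'Hom(E, F),
    [/\ is_gr_hom phi,
        forall b, phi (ext_inc E b) = ext_inc F b &
        forall e, ext_prj F (phi e) = ext_prj E e].

Definition ext_split (E : extension) : Prop :=
  exists s : 'Hom(A, E), is_gr_hom s /\ forall a, ext_prj E (s a) = a.

Definition in_fibre (E F : extension) (u : E * F) : Prop :=
  ext_prj E u.1 = ext_prj F u.2.

(* G represents the Baer sum [E] + [F].  The map q, relevant only on the fibre *)
(* product E x_A F, is a morphism of G inducing G ~ E x_A F / {(b, -b)}: the   *)
(* last two conditions make it a morphism of extensions from                   *)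
(* 0 -> B + B -> E x_A F -> A -> 0 to G lying over the addition B + B -> B.    *)
Definition is_baer_sum (E F G : extension) : Prop :=
  exists q : 'Hom((E * F)%type, G),
    [/\ forall (x : current g) e f, in_fibre (e, f) ->
          q (act x e, act x f) = act x (q (e, f)),
        forall r e f, in_fibre (e, f) -> e \in deg E r -> f \in deg F r ->
          q (e, f) \in deg G r,
        forall b c, q (ext_inc E b, ext_inc F c) = ext_inc G (b + c) &
        forall e f, in_fibre (e, f) -> ext_prj G (q (e, f)) = ext_prj E e].

(* F represents c [E], the pushout of E along c : B -> B. *)
Definition is_baer_scale (c : K) (E F : extension) : Prop :=
  exists phi : 'Hom(E, F),
    [/\ is_gr_hom phi,
        forall b, phi (ext_inc E b) = ext_inc F (c *: b) &
        forall e, ext_prj F (phi e) = ext_prj E e].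

(* Ext^1_G(A, B) = 0: the zero class is that of the split extensions. *)
Definition Ext1_zero : Prop := forall E : extension, ext_split E.

(* Ext^1_G(A, B) ~ U as vector spaces: u |-> [Phi u] is a linear bijection     *)
(* from U onto the classes of extensions.                                      *)
Definition Ext1_iso (U : lmodType K) : Prop :=
  exists Phi : U -> extension,
    [/\ forall u v, ext_equiv (Phi u) (Phi v) -> u = v,
        forall E, exists u, ext_equiv E (Phi u),
        forall u v, is_baer_sum (Phi u) (Phi v) (Phi (u + v)) &
        forall c u, is_baer_scale c (Phi u) (Phi (c *: u))].

End Ext.
End CategoryG.

(* Main.v *)
Require Import Defs.
From HB Require Import structures.
From mathcomp Require Import all_boot all_order all_algebra.
From mathcomp Require Import complex spectral.
From mathcomp Require Import boolp reals.

Set Implicit Arguments.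
Unset Strict Implicit.
Unset Printing Implicit Defensive.

Import Order.TTheory GRing.Theory Num.Theory VectorInternalTheory.
Local Open Scope ring_scope.

(* A graded linear section of an extension of V(lambda, r) by V(mu, s) turns   *)
(* it into a cocycle c : g[t] -> Hom(V(lambda), V(mu)), and for degree reasons *)
(* c(x t^k) = 0 unless r + k = s.                                              *)
(* - If s = r, then c is a cocycle of g, hence a coboundary by Whitehead's     *)
(*   first lemma.                                                              *)
(* - If s > r + 1, then c([x,y] t^(s-r)) = 0 by the cocycle rule applied to    *)
(*   x t and y t^(s-r-1); as g = [g,g], c = 0.                                 *)
(* - If s = r + 1, then x |-> c(x t) is an arbitrary g-equivariant map, and    *)
(*   the Killing form identifies these with Hom_g(V(lambda), g (x) V(mu)).     *)
(* If moreover mu - lambda is neither a root nor 0, comparing weights on the   *)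
(* highest weight vector and on a functional killed by the negative root       *)
(* spaces shows that the equivariant map is 0.                                 *)
(* Whitehead's lemma and the nondegeneracy of the Killing form come from the   *)
(* vanishing of every representation with zero trace form; for that, it is     *)
(* enough to use one element d of h on which all simple roots take the value   *)
(* 1, since ad d is diagonalizable with real eigenvalues, not all zero.        *)

(** * Spectral projections of a complex matrix *)

(** A linear section [sigma] of an extension E, with values in degree r, fails to commute with g[t]
    by a 1-cocycle c with values in Hom(V(lambda), V(mu)). As V(mu, s) lives in the single degree s,
    c(x t^k) can be nonzero only for k = s - r ([ext_cocycle]). So nothing is left for s < r; for s
    = r Whitehead's lemma ([cocycle_coboundary]) corrects [sigma]; for k >= 2, brackets of lower
    positive powers of t span g t^k and force c = 0.

    For k = 1 the section in degree r is unique, so there are no coboundaries: extensions correspond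
    exactly to equivariant maps phi from g to Hom(V(lambda), V(mu)). The extension of phi is
    [twist_ext], and [twist_equiv_surj] and [twist_equiv_inj] give the bijection. The Killing form,
    invariant and nondegenerate, moves g to the other side ([contract_exists], [contract_inj],
    [contract_surj]).

    Whitehead's lemma and the nondegeneracy both rest on [cartan_criterion]. The covering condition
    comes from [weight_equivariant_eq0]: a functional of weight mu on V(mu), killed by lowering
    elements, can detect phi y v, for v a highest weight vector, only if y has weight mu -
    lambda. *)

Section Spectrum.
Variables (C : numClosedFieldType) (n : nat).
Implicit Types (A X : 'M[C]_n.+1) (p q F G : {poly C}).

Lemma trig_mxM A X : is_trig_mx A -> is_trig_mx X ->
  is_trig_mx (A * X) /\ forall i, (A * X) i i = A i i * X i i.
Proof.
move=> /is_trig_mxP tA /is_trig_mxP tX; split=> [|i].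
  apply/is_trig_mxP => i j ij; rewrite mxE big1// => k _.
  have [ik|ki] := ltnP i k; first by rewrite tA// mul0r.
  by rewrite tX ?mulr0// (leq_ltn_trans ki).
rewrite mxE (bigD1 i)//= big1 ?addr0// => k; rewrite neq_ltn => /orP[ki|ik].
  by rewrite (tX k i)// mulr0.
by rewrite tA// mul0r.
Qed.

Lemma trig_horner_mx A p : is_trig_mx A ->
  is_trig_mx (horner_mx A p) /\ forall i, horner_mx A p i i = p.[A i i].
Proof.
move=> tA; elim/poly_ind: p => [|p c [IHt IHd]].
  rewrite rmorph0; split=> [|i]; last by rewrite mxE horner0.
  by apply/is_trig_mxP => i j _; rewrite mxE.
rewrite rmorphD rmorphM /= horner_mx_X horner_mx_C.
have [tM dM] := trig_mxM IHt tA; split=> [|i].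
  apply/is_trig_mxP => i j ij; rewrite !mxE.
  have /is_trig_mxP/(_ i j ij) := tM; rewrite mxE => ->.
  by rewrite -val_eqE /= ltn_eqF// mulr0n addr0.
by rewrite mxE dM IHd mxE eqxx mulr1n !hornerE.
Qed.

(** By Schur triangularization, e is the diagonal of a triangular matrix similar to A, on which
    polynomials act entry by entry. Sums over eigenvalues with multiplicity thus become traces of
    polynomials in A. *)
Lemma spectrum_exists A : exists e : 'I_n.+1 -> C,
  char_poly A = \prod_i ('X - (e i)%:P) /\
  forall p, \tr (horner_mx A p) = \sum_i p.[e i].
Proof.
have [P /unitarymx_unit Pu tA] := Schur A isT.
have [T tT PT] : exists2 T, is_trig_mx T & P *m A = T *m P.
  by exists (conjmx P A) => //; apply/(simmxP Pu); rewrite /simmx_to_for /=.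
exists (fun i => T i i); split.
  rewrite -char_poly_trig//.
  have -> : A = invmx P *m T *m P by rewrite -mulmxA -PT mulKmx.
  rewrite /char_poly /char_poly_mx !map_mxM /=.
  set Q := map_mx _ P; set Q' := map_mx _ (invmx P).
  have QQ : Q' *m Q = 1%:M by rewrite -map_mxM mulVmx// map_mx1.
  set N := map_mx _ T.
  have -> : 'X%:M - Q' *m N *m Q = Q' *m ('X%:M - N) *m Q.
    by rewrite mulmxBr mulmxBl scalar_mxC -(mulmxA 'X%:M) QQ mulmx1.
  by rewrite !det_mulmx mulrAC -det_mulmx QQ det1 mul1r.
move=> p; have -> : \sum_i p.[T i i] = \tr (horner_mx T p).
  by apply: eq_bigr => i _; rewrite (trig_horner_mx p tT).2.
have TE : T = P *m A *m invmx P by rewrite PT mulmxK.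
suff -> : horner_mx T p = P *m horner_mx A p *m invmx P.
  by rewrite mxtrace_mulC mulmxA mulVmx// mul1mx.
rewrite TE; elim/poly_ind: p => [|p c IH]; first by rewrite !rmorph0 mulmx0 mul0mx.
rewrite !rmorphD !rmorphM /= !horner_mx_X !horner_mx_C IH mulmxDr mulmxDl.
congr (_ + _); last by rewrite scalar_mxC -mulmxA mulmxV// mulmx1.
by rewrite -!mulmxE !mulmxA mulmxKV.
Qed.

Lemma mxtrace_nilpotent A k : A ^+ k = 0 -> \tr A = 0.
Proof.
move=> Ak0; have [e [eA eT]] := spectrum_exists A.
have := eT 'X; rewrite horner_mx_X => ->; apply: big1 => i _; rewrite hornerX.
have : eigenvalue A (e i).
  by rewrite eigenvalue_root_char eA rootE horner_prod (bigD1 i)//= hornerXsubC subrr mul0r.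
case/eigenvalueP => v vA v0.
have : v *m A ^+ k = (e i) ^+ k *: v.
  elim: k {Ak0} => [|k IH]; first by rewrite !expr0 scale1r mulmx1.
  by rewrite exprSr -mulmxE mulmxA IH -scalemxAl vA scalerA -exprSr.
rewrite Ak0 mulmx0 => /esym/eqP; rewrite scaler_eq0 (negPf v0) orbF.
by rewrite expf_eq0 => /andP[_ /eqP].
Qed.

(** Fitting decomposition: p(A) projects onto the part where A is invertible, with inverse q(A), and
    A is nilpotent on the complement. *)
Lemma fitting_mx A : exists p q, exists k,
  [/\ horner_mx A p * horner_mx A p = horner_mx A p,
      A * horner_mx A q = horner_mx A p &
      A ^+ k * (1 - horner_mx A p) = 0].
Proof.
have [m [q]] := multiplicity_XsubC (char_poly A) 0.
rewrite -size_poly_eq0 size_char_poly subr0 /= => q0 cE.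
(* The exponent is m + 1 rather than m so that the projector is divisible by X even when A is
   invertible; dividing by X gives the inverse. *)
have : coprimep ('X ^+ m.+1) q.
  by rewrite coprimep_expl// coprimep_sym -['X]subr0 coprimep_XsubC.
case/Bezout_eq1_coprimepP => -[u v] /= uv.
have z : horner_mx A (q * 'X^m) = 0 by rewrite -cE Cayley_Hamilton.
have z' : horner_mx A (q * 'X^(m.+1)) = 0 by rewrite exprSr mulrA rmorphM /= z mul0r.
exists (u * 'X^(m.+1)), (u * 'X^m), m.+1.
have E : 1 - horner_mx A (u * 'X^(m.+1)) = horner_mx A (v * q).
  by rewrite -(rmorph1 (horner_mx A)) -rmorphB -uv addrC addKr.
split.
- apply/esym/eqP; rewrite -subr_eq0 -{1}[horner_mx _ _]mulr1 -mulrBr E -rmorphM.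
  by rewrite mulrACA ['X^_ * _]mulrC rmorphM /= z' mulr0.
- by rewrite -{1}[A]horner_mx_X -rmorphM mulrCA -exprS.
- rewrite E -{1}[A]horner_mx_X -rmorphXn -rmorphM.
  by rewrite mulrCA ['X^_ * _]mulrC rmorphM /= z' mulr0.
Qed.

(* X shifts generalized A-eigenvalues by k, so it sends an F-primary vector to *)
(* a vector primary for the shift of F, which has no component on G.           *)
Lemma primary_shift A X k F G : horner_mx A (F * G) = 0 ->
  (A + k%:M) * X = X * A -> coprimep (F \Po ('X + k%:P)) G ->
  horner_mx A F * X * horner_mx A G = 0.
Proof.
move=> FG0 AX /Bezout_eq1_coprimepP[[u v] /= uv].
have shift p : horner_mx A (p \Po ('X + k%:P)) * X = X * horner_mx A p.
  elim/poly_ind: p => [|p c IH]; first by rewrite comp_poly0 !rmorph0 mulr0 mul0r.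
  rewrite [p * 'X]mulrC comp_polyD comp_polyM comp_polyX comp_polyC.
  rewrite !(rmorphD, rmorphM) /= horner_mx_X !horner_mx_C mulrDl mulrDr -mulrA IH.
  by rewrite mulrA AX -mulrA; congr (_ + _); rewrite -mulmxE scalar_mxC.
set Y := X * horner_mx A G.
have FY : horner_mx A (F \Po ('X + k%:P)) * Y = 0.
  by rewrite mulrA shift -mulrA -rmorphM /= FG0 mulr0.
have -> : horner_mx A F * X * horner_mx A G = horner_mx A F * Y by rewrite mulrA.
have -> : Y = horner_mx A v * (horner_mx A G * Y).
  rewrite -[LHS]mul1r -(rmorph1 (horner_mx A)) -uv rmorphD !rmorphM /=.
  by rewrite mulrDl -mulrA FY mulr0 add0r mulrA.
by rewrite 2!mulrA -!rmorphM /= mulrAC mulrC rmorphM /= FG0 mulr0 mul0r.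
Qed.

End Spectrum.

(** * Vanishing of representations with zero trace form *)

Lemma lfun_of_linear (K : fieldType) (U V : vectType K) (f : U -> V) :
  linear f -> exists F : 'Hom(U, V), F =1 f.
Proof.
move=> fl; pose f' : {linear U -> V} := HB.pack f (GRing.isLinear.Build K U V _ f fl).
by exists (linfun f') => x; rewrite lfunE.
Qed.

(** * Consequences of simplicity *)

Section SimpleLie.
Variables (K : fieldType) (g : vectLieAlgType K).
Hypothesis g_simple : lie_simple g.

Lemma simple_perfect (U : {vspace g}) : (forall x y, lie x y \in U) -> U = fullv.
Proof.
have [[x [y xy0]] simpl] := g_simple => Ulie.
have [U0|//] := simpl U (fun x y _ => Ulie x y).
by move: (Ulie x y) xy0; rewrite U0 memv0 => ->.
Qed.

Lemma simple_linear0 (V : vectType K) (f : g -> V) : linear f ->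
  (forall x y, f (lie x y) = 0) -> forall x, f x = 0.
Proof.
move=> /lfun_of_linear[F FE] f0 x; rewrite -FE; apply/eqP; rewrite -memv_ker.
by rewrite (@simple_perfect (lker F)) ?memvf// => y z; rewrite memv_ker FE f0.
Qed.

Lemma simple_kernel (V : vectType K) (f : g -> V) : linear f ->
  (forall x y, f y = 0 -> f (lie x y) = 0) ->
  (forall x, f x = 0) \/ (forall x, f x = 0 -> x = 0).
Proof.
move=> /lfun_of_linear[F FE] f0; have [_ simpl] := g_simple.
have Fideal : lie_ideal (lker F) by move=> x y; rewrite !memv_ker !FE => /eqP/f0->.
have [k0|kf] := simpl _ Fideal.
- by right=> x fx0; apply/eqP; rewrite -memv0 -k0 memv_ker FE fx0.
- by left=> x; apply/eqP; rewrite -FE -memv_ker kf memvf.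
Qed.

End SimpleLie.

(* Matrices act on row vectors from the right, as act_mx does; hence the       *)
(* reversed order of the products.                                             *)
Definition mx_rep (K : fieldType) (L : lieAlgType K) n (rho : L -> 'M[K]_n) :=
  linear rho /\
  forall x y, rho (lie x y) = rho y *m rho x - rho x *m rho y.

(** The second clause says that the eigenvectors of ad d with real eigenvalues span g, in the form
    of an induction principle over subspaces. *)
Definition real_semisimple (C : numClosedFieldType) (g : vectLieAlgType C) (d : g) :=
  (exists x, lie d x != 0) /\
  forall U : {vspace g},
    (forall a x, a \is Num.real -> lie d x = a *: x -> x \in U) -> U = fullv.

Section CartanCriterion.
Variables (C : numClosedFieldType) (g : vectLieAlgType C).
Hypothesis g_simple : lie_simple g.
Variable d : g.
Hypothesis d_ss : real_semisimple d.

Lemma real_semisimple_eigenvector :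
  exists a x, [/\ a \is Num.real, a != 0, x != 0 & lie d x = a *: x].
Proof.
have [[x0 dx0] gen] := d_ss; apply: contrapT => H.
have [F FE] := lfun_of_linear (lie_linearr d).
move/eqP: dx0; apply; apply/eqP; rewrite -FE -memv_ker.
rewrite (gen (lker F)) ?memvf// => a x ar dx; rewrite memv_ker FE dx.
have [->|a0] := eqVneq a 0; first by rewrite scale0r.
have [->|x_neq0] := eqVneq x 0; first by rewrite scaler0.
by case: H; exists a, x.
Qed.

(** The eigenvalues of rho(d) are first shown to be real. Their squares sum to tr rho(d)^2 = 0, so
    they vanish and rho(d) is nilpotent. An eigenvector x of ad d with eigenvalue a != 0 intertwines
    the nilpotent rho(d) with the invertible rho(d) + a, hence rho(x) = 0, and the kernel of rho is
    a nonzero ideal. *)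
Lemma cartan_criterion n (rho : g -> 'M[C]_n) : mx_rep rho ->
  (forall x y, \tr (rho x *m rho y) = 0) -> forall x, rho x = 0.
Proof.
case: n rho => [|n] rho [rl rlie] tr0; first by move=> x; apply: flatmx0.
have [R RE] := lfun_of_linear rl.
pose A := rho d; have [e [eA eT]] := spectrum_exists A.
have shiftA a x : lie d x = a *: x -> (A + a%:M) * rho x = rho x * A.
  move=> dx; have := rlie d x; rewrite dx -RE linearZ /= RE => E.
  by rewrite mulrDl -[a%:M * _]/(a%:M *m rho x) mul_scalar_mx E addrC subrK.
(* P projects onto the generalized eigenspaces whose eigenvalue has imaginary  *)
(* part 'Im (e i0). It commutes with rho because ad d has real eigenvalues, so *)
(* tr (P rho _) kills brackets, hence g, and these eigenvalues sum to 0.       *)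
have e_real i0 : 'Im (e i0) = 0.
  pose c i := 'Im (e i) == 'Im (e i0).
  pose F := \prod_(i | c i) ('X - (e i)%:P).
  pose G := \prod_(i | ~~ c i) ('X - (e i)%:P).
  have FG : char_poly A = F * G by rewrite eA (bigID c).
  have FG0 : horner_mx A (F * G) = 0 by rewrite -FG Cayley_Hamilton.
  have GF0 : horner_mx A (G * F) = 0 by rewrite mulrC.
  have rootF x : root F x -> 'Im x = 'Im (e i0).
    rewrite rootE horner_prod prodf_seq_eq0 => /hasP[i _ /andP[/eqP ci]].
    by rewrite hornerXsubC subr_eq0 => /eqP->.
  have rootG x : root G x -> 'Im x != 'Im (e i0).
    rewrite rootE horner_prod prodf_seq_eq0 => /hasP[i _ /andP[ci]].
    by rewrite hornerXsubC subr_eq0 => /eqP->.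
  (* A real shift preserves imaginary parts, so roots of the shifted F and of G never meet. *)
  have cop0 (a : C) : a \is Num.real -> coprimep (F \Po ('X + a%:P)) G.
    move=> ar; apply/Pdiv.ClosedField.coprimepP => x; rewrite root_comp hornerD hornerX hornerC.
    move=> /rootF Fx; apply/negP => /rootG /eqP; apply; rewrite -Fx raddfD /=.
    by rewrite (Creal_ImP _ ar) addr0.
  have cop1 (a : C) : a \is Num.real -> coprimep (G \Po ('X + a%:P)) F.
    move=> ar; apply/Pdiv.ClosedField.coprimepP => x; rewrite root_comp hornerD hornerX hornerC.
    move=> /rootG Gx; apply/negP => /rootF Fx; move/eqP: Gx; apply; rewrite -Fx raddfD /=.
    by rewrite (Creal_ImP _ ar) addr0.
  have : coprimep F G by have := cop0 _ (rpred0 _); rewrite addr0 comp_polyXr.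
  case/Bezout_eq1_coprimepP => -[u v] /= uv.
  pose P := horner_mx A (v * G).
  have Pcomm x : P * rho x = rho x * P.
    have [H HE] : exists H : 'Hom(g, 'M[C]_n.+1), forall x, H x = P * rho x - rho x * P.
      apply: lfun_of_linear => k y z; rewrite rl mulrDl mulrDr.
      by rewrite -!mulmxE -scalemxAr -scalemxAl scalerBr opprD addrACA.
    suff : x \in lker H by rewrite memv_ker HE subr_eq0 => /eqP.
    have [_ gen] := d_ss; rewrite (gen (lker H)) ?memvf// => a y ar /shiftA Ay; rewrite memv_ker HE.
    have Q : 1 - P = horner_mx A (u * F).
      by rewrite -(rmorph1 (horner_mx A)) -uv rmorphD /= addrK.
    (* Both off-diagonal blocks of rho y for the decomposition given by P vanish, which is
       commutation with P. *)
    have z1 : (1 - P) * rho y * P = 0.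
      rewrite Q /P rmorphM [v * G]mulrC rmorphM /= !mulrA.
      rewrite -(mulrA _ _ (rho y)) -(mulrA _ _ (horner_mx A G)).
      by rewrite (primary_shift FG0 Ay (cop0 _ ar)) mulr0 mul0r.
    have z2 : P * rho y * (1 - P) = 0.
      rewrite Q /P rmorphM [u * F]mulrC rmorphM /= !mulrA.
      rewrite -(mulrA _ _ (rho y)) -(mulrA _ _ (horner_mx A F)).
      by rewrite (primary_shift GF0 Ay (cop1 _ ar)) mulr0 mul0r.
    move/eqP: z1; rewrite mulrBl mul1r mulrBl subr_eq0 => /eqP->.
    by move: z2; rewrite mulrBr mulr1 => ->.
  have trP x : \tr (P *m rho x) = 0.
    have trl : linear (fun x => \tr (P *m rho x) : C^o).
      by move=> k y z; rewrite rl mulmxDr -scalemxAr mxtraceD mxtraceZ.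
    apply: (simple_linear0 g_simple trl) => y z.
    rewrite rlie mulmxBr raddfB /= !mulmxA.
    rewrite -[P *m rho y]/(P * rho y) Pcomm -[rho y * P]/(rho y *m P).
    by rewrite -[rho y *m P *m _]mulmxA [\tr (rho y *m _)]mxtrace_mulC subrr.
  (* The polynomial [v * G] is 1 at the eigenvalues selected by [c] and 0 at the others, so [trP d]
     is this sum. *)
  have sum0 : \sum_(i | c i) e i = 0.
    have := trP d; rewrite -[P *m _]/(P * A) -[A in P * A]horner_mx_X -rmorphM /= eT.
    rewrite (bigID c) /= [X in _ + X]big1 ?addr0 => [E|i nci].
      rewrite -[RHS]E; apply: eq_bigr => i ci; rewrite hornerM hornerX.
      have -> : (v * G).[e i] = 1.
        have <- : (u * F + v * G).[e i] = 1 by rewrite uv hornerC.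
        rewrite hornerD [(u * F).[_]]hornerM [F.[_]]horner_prod (bigD1 i)//= hornerXsubC subrr.
        by rewrite mul0r mulr0 add0r.
      by rewrite mul1r.
    rewrite !hornerM [G.[_]]horner_prod (bigD1 i)//= hornerXsubC subrr.
    by rewrite mul0r mulr0 mul0r.
  have : 'Im (\sum_(i | c i) e i) = 0 by rewrite sum0 raddf0.
  rewrite raddf_sum /= (eq_bigr (fun=> 'Im (e i0))) => [|i /eqP//].
  rewrite sumr_const => /eqP; rewrite mulrn_eq0 => /orP[/eqP/card0_eq/(_ i0)|/eqP//].
  by rewrite !inE => /eqP.
have e0 i : e i = 0.
  have er j : e j \is Num.real by apply/Creal_ImP.
  have : \sum_j e j ^+ 2 = 0.
    have := tr0 d d; rewrite -[_ *m _]/(A * A) -expr2 -[A]horner_mx_X -rmorphXn /= eT.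
    by move=> E; rewrite -[RHS]E; apply: eq_bigr => j _; rewrite hornerXn.
  move/eqP; rewrite psumr_eq0 => [|j _]; last by rewrite /= -realEsqr.
  by move/allP/(_ i (mem_index_enum _)) => /=; rewrite sqrf_eq0 => /eqP.
have An : A ^+ n.+1 = 0.
  have := Cayley_Hamilton A; rewrite eA.
  under eq_bigr do rewrite e0 subr0.
  by rewrite prodr_const card_ord rmorphXn /= horner_mx_X.
have [a [x [ar a0 x0 dx]]] := real_semisimple_eigenvector.
have rx : rho x = 0.
  have pow k : (A + a%:M) ^+ k * rho x = rho x * A ^+ k.
    elim: k => [|k IH]; first by rewrite !expr0 mul1r mulr1.
    by rewrite exprSr -mulrA (shiftA _ _ dx) mulrA IH -mulrA -exprSr.
  have : A + a%:M \in unitmx.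
    rewrite -row_free_unit -kermx_eq0; apply: contraT => k0.
    have : eigenvalue A (- a) by rewrite /eigenvalue /eigenspace raddfN opprK.
    rewrite eigenvalue_root_char eA rootE horner_prod prodf_seq_eq0 => /hasP[i _].
    by rewrite hornerXsubC e0 subr0 oppr_eq0 (negPf a0).
  move=> Au; have := pow n.+1; rewrite An mulr0 => E.
  by rewrite -[rho x](mulKr (unitrX n.+1 Au)) E mulr0.
have rker y z : rho z = 0 -> rho (lie y z) = 0.
  by move=> rz; rewrite rlie rz mulmx0 mul0mx subrr.
have [//|inj] := simple_kernel g_simple rl rker.
by move/eqP: x0; rewrite (inj _ rx).
Qed.

End CartanCriterion.

(** * Whitehead's first lemma *)

Section TraceForm.
Variables (C : numClosedFieldType) (g : vectLieAlgType C).
Hypothesis g_simple : lie_simple g.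
Variable d : g.
Hypothesis d_ss : real_semisimple d.

Definition trace_form n (rho : g -> 'M[C]_n) x y := \tr (rho x *m rho y).

Definition std_basis (V : vectType C) (i : 'I_(dim V)) : V := r2v (delta_mx 0 i).

Lemma std_basis_sum (V : vectType C) (v : V) : v = \sum_i v2r v 0 i *: std_basis i.
Proof.
rewrite -{1}[v]v2rK [v2r v in LHS]row_sum_delta linear_sum.
by apply: eq_bigr => i _; rewrite linearZ.
Qed.

Definition trace_gram n (rho : g -> 'M[C]_n) : 'M[C]_(dim g) :=
  \matrix_(i, j) trace_form rho (std_basis i) (std_basis j).

Section Rep.
Variables (n : nat) (rho : g -> 'M[C]_n).
Hypothesis rho_rep : mx_rep rho.

Lemma trace_formC x y : trace_form rho x y = trace_form rho y x.
Proof. exact: mxtrace_mulC. Qed.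

Lemma trace_form_linearl y : linear (fun x => trace_form rho x y : C^o).
Proof.
have [rl _] := rho_rep => k x x'.
by rewrite /trace_form rl mulmxDl -scalemxAl mxtraceD mxtraceZ.
Qed.

Lemma trace_form_linearr x : linear (fun y => trace_form rho x y : C^o).
Proof.
by move=> k y y'; rewrite !(trace_formC x) trace_form_linearl.
Qed.

Lemma trace_form_inv x y z :
  trace_form rho (lie x y) z = - trace_form rho y (lie x z).
Proof.
have [_ rlie] := rho_rep.
have trB (X Y : 'M[C]_n) : \tr (X - Y) = \tr X - \tr Y by exact: raddfB.
rewrite /trace_form !rlie mulmxBl mulmxBr !trB opprB !mulmxA; congr (_ - _).
by rewrite -[in LHS]mulmxA [in LHS]mxtrace_mulC.
Qed.

Lemma trace_gramE x y :
  trace_form rho x y = (v2r x *m trace_gram rho *m (v2r y)^T) 0 0.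
Proof.
have [F FE] := lfun_of_linear (trace_form_linearl y).
rewrite -FE {1}(std_basis_sum x) linear_sum -mulmxA mxE; apply: eq_bigr => i _.
rewrite linearZ /= FE mxE; congr (_ * _).
have [G GE] := lfun_of_linear (trace_form_linearr (std_basis i)).
rewrite -GE {1}(std_basis_sum y) linear_sum; apply: eq_bigr => j _.
by rewrite linearZ /= GE !mxE mulrC.
Qed.

Lemma trace_gramT : (trace_gram rho)^T = trace_gram rho.
Proof. by apply/matrixP => i j; rewrite !mxE trace_formC. Qed.

(** Invariance makes the radical of the trace form an ideal; by [cartan_criterion] it is not all of
    g, so it is 0. *)
Lemma trace_gram_unit : (exists x, rho x != 0) -> trace_gram rho \in unitmx.
Proof.
move=> [x0 rx0]; pose f x := v2r x *m trace_gram rho.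
have fl : linear f by move=> k x y; rewrite /f linearP /= mulmxDl scalemxAl.
have fE x j : f x 0 j = trace_form rho x (std_basis j).
  rewrite trace_gramE -/(f x) /std_basis r2vK trmx_delta.
  by rewrite -colE [RHS]mxE.
have f0 x : f x = 0 -> forall y, trace_form rho x y = 0.
  by move=> fx y; rewrite trace_gramE -/(f x) fx mul0mx mxE.
have fker x y : f y = 0 -> f (lie x y) = 0.
  by move=> /f0 fy; apply/rowP => j; rewrite fE trace_form_inv fy oppr0 mxE.
have [z|inj] := simple_kernel g_simple fl fker.
  move/eqP: rx0; case; apply: (cartan_criterion g_simple d_ss rho_rep) => x y.
  exact: f0.
rewrite -row_free_unit -kermx_eq0; apply/eqP/row_matrixP => i.
rewrite row0; apply: r2v_inj; rewrite linear0; apply: inj.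
by rewrite /f r2vK -row_mul mulmx_ker row0.
Qed.

Lemma trace_form_dual : (exists x, rho x != 0) -> exists b' : 'I_(dim g) -> g,
  (forall x j, trace_form rho x (b' j) = v2r x 0 j) /\
  (forall x, x = \sum_j trace_form rho x (std_basis j) *: b' j).
Proof.
move=> /trace_gram_unit Bu; set B := trace_gram rho in Bu *.
exists (fun j => r2v (row j (invmx B))); split=> [x j|x].
  rewrite trace_gramE r2vK tr_row trmx_inv trace_gramT -/B.
  by rewrite colE mulmxA mulmxK// -colE [LHS]mxE.
apply: v2r_inj; rewrite linear_sum /= -[LHS](mulmxK Bu) [LHS]mulmx_sum_row.
apply: eq_bigr => j _; rewrite linearZ /= r2vK; congr (_ *: _).
by rewrite trace_gramE /std_basis r2vK trmx_delta -colE [RHS]mxE.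
Qed.

Variable b' : 'I_(dim g) -> g.
Hypothesis b'P : forall x j, trace_form rho x (b' j) = v2r x 0 j.
Hypothesis b'_sum : forall x, x = \sum_j trace_form rho x (std_basis j) *: b' j.

(** Invariance of the Casimir tensor: ad y has opposite transposed matrices in the dual bases. An
    arbitrary bilinear [Psi] allows two uses below, with products of operators (Cas is central) and
    with the cocycle (the equation for [m]). *)
Lemma casimir_invariant (V : vectType C) (Psi : g -> g -> V) y :
  (forall v, linear (Psi^~ v)) -> (forall u, linear (Psi u)) ->
  \sum_j (Psi (lie y (b' j)) (std_basis j) + Psi (b' j) (lie y (std_basis j))) = 0.
Proof.
move=> Pl Pr; rewrite big_split /=.
have -> : \sum_j Psi (lie y (b' j)) (std_basis j) = \sum_j \sum_k
    trace_form rho (lie y (b' j)) (std_basis k) *: Psi (b' k) (std_basis j).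
  apply: eq_bigr => j _; have [F FE] := lfun_of_linear (Pl (std_basis j)).
  rewrite -FE {1}(b'_sum (lie y (b' j))) linear_sum.
  by apply: eq_bigr => k _; rewrite linearZ /= FE.
have -> : \sum_j Psi (b' j) (lie y (std_basis j)) = \sum_j \sum_k
    trace_form rho (lie y (std_basis j)) (b' k) *: Psi (b' j) (std_basis k).
  apply: eq_bigr => j _; have [F FE] := lfun_of_linear (Pr (b' j)).
  rewrite -FE {1}(std_basis_sum (lie y (std_basis j))) linear_sum.
  by apply: eq_bigr => k _; rewrite linearZ /= FE b'P.
rewrite exchange_big -big_split big1// => j _ /=.
rewrite -big_split big1// => k _ /=.
by rewrite -scalerDl trace_form_inv trace_formC addNr scale0r.
Qed.

End Rep.

(* The Casimir element Cas of the trace form of rho satisfies                  *)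
(* m rho(y) = c(y) Cas, which makes c a coboundary on the part of the module   *)
(* where Cas is invertible; that part is nonzero as tr Cas = dim g. Induct on  *)
(* the complementary Fitting component, cut out by the idempotent P.           *)
Lemma cocycle_coboundary n (rho : g -> 'M[C]_n) (c : g -> 'rV[C]_n) :
  mx_rep rho -> linear c ->
  (forall x y, c (lie x y) = c y *m rho x - c x *m rho y) ->
  exists m, forall x, c x = m *m rho x.
Proof.
(* The idempotent [P] stands for a direct summand of the module, so that the matrix size stays fixed
   while the rank of [P] decreases. *)
suff H (P : 'M[C]_n) : P *m P = P -> mx_rep rho ->
    (forall x, P *m rho x = rho x) -> (forall x, rho x *m P = rho x) ->
    linear c -> (forall x y, c (lie x y) = c y *m rho x - c x *m rho y) ->
    exists m, forall x, c x = m *m rho x.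
  by move=> rr cl cc; apply: (H 1%:M) => // *; rewrite ?mul1mx ?mulmx1.
case: n rho c P => [|n] rho c P; first by exists 0 => x; rewrite mul0mx thinmx0.
have [r] := ubnP (\rank P); elim: r => // r IH in rho c P *; rewrite ltnS => rP.
move=> PP rr Prho rhoP cl cc.
have [rho0|/existsNP[x0 /eqP rx0]] := pselect (forall x, rho x = 0).
  exists 0 => x; rewrite mul0mx; apply: (simple_linear0 g_simple cl) => y z.
  by rewrite cc !rho0 !mulmx0 subr0.
have [b' [b'P b'_sum]] := trace_form_dual rr (ex_intro _ x0 rx0).
have [rl rlie] := rr.
pose Cas := \sum_j rho (b' j) *m rho (std_basis j).
have Cas_comm y : Cas *m rho y = rho y *m Cas.
  have := casimir_invariant rr b'P b'_sum y (Psi := fun u v => rho u *m rho v).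
  have Pl v : linear ((fun u v => rho u *m rho v)^~ v).
    by move=> k u u'; rewrite rl mulmxDl scalemxAl.
  have Pr u : linear ((fun u v => rho u *m rho v) u).
    by move=> k v v'; rewrite rl mulmxDr scalemxAr.
  move=> /(_ Pl Pr) E; apply/eqP; rewrite -subr_eq0 -E; apply/eqP.
  rewrite mulmx_suml mulmx_sumr -sumrB; apply: eq_bigr => j _.
  by rewrite !rlie mulmxBl mulmxBr !mulmxA [RHS]addrC addrA subrK.
pose m := \sum_j c (b' j) *m rho (std_basis j).
have mE y : m *m rho y = c y *m Cas.
  have := casimir_invariant rr b'P b'_sum y (Psi := fun u v => c u *m rho v).
  have Pl v : linear ((fun u v => c u *m rho v)^~ v).
    by move=> k u u'; rewrite cl mulmxDl scalemxAl.
  have Pr u : linear ((fun u v => c u *m rho v) u).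
    by move=> k v v'; rewrite rl mulmxDr scalemxAr.
  move=> /(_ Pl Pr) E; apply/eqP; rewrite -subr_eq0 -E; apply/eqP.
  rewrite mulmx_suml mulmx_sumr -sumrB; apply: eq_bigr => j _.
  by rewrite cc !rlie mulmxBl mulmxBr !mulmxA [RHS]addrC addrA subrK.
have trCas : \tr Cas != 0.
  rewrite raddf_sum /= (eq_bigr (fun=> 1)) => [|j _]; last first.
    by rewrite mxtrace_mulC -/(trace_form rho _ _) b'P /std_basis r2vK mxE !eqxx.
  rewrite sumr_const card_ord pnatr_eq0; apply: contra rx0 => /eqP g0.
  have -> : x0 = 0.
    by rewrite (std_basis_sum x0) big1// => -[i lt_i]; exfalso; move: (lt_i); rewrite g0.
  by have := rl (-1) 0 0; rewrite scaler0 addr0 scaleN1r addNr => ->.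
have [p [q [k [P1P1 CQ nil]]]] := fitting_mx Cas.
set P1 := horner_mx Cas p in P1P1 CQ nil; set Q := horner_mx Cas q in CQ.
have commP1 y : P1 *m rho y = rho y *m P1.
  by apply/esym; apply: comm_mx_horner; rewrite /comm_mx Cas_comm.
have commQ y : Q *m rho y = rho y *m Q.
  by apply/esym; apply: comm_mx_horner; rewrite /comm_mx Cas_comm.
have CasP : Cas *m P = Cas.
  by rewrite mulmx_suml; apply: eq_bigr => j _; rewrite -mulmxA rhoP.
have PCas : P *m Cas = Cas.
  by rewrite mulmx_sumr; apply: eq_bigr => j _; rewrite mulmxA Prho.
have PP1 : P *m P1 = P1 by rewrite -CQ -mulmxE mulmxA PCas.
have P1P : P1 *m P = P1.
  by rewrite -[RHS]PP1; apply/esym/comm_mx_horner; rewrite /comm_mx CasP.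
have P1_neq0 : P1 != 0.
  apply: contra trCas => /eqP P10; move: nil; rewrite P10 subr0 mulr1.
  by move/mxtrace_nilpotent => ->.
pose P0 := 1%:M - P1.
have P0P0 : P0 *m P0 = P0.
  by rewrite {2}/P0 mulmxBr mulmx1 mulmxBl mul1mx -[P1 *m P1]/(P1 * P1) P1P1 subrr subr0.
have commP0 y : P0 *m rho y = rho y *m P0.
  by rewrite mulmxBl mulmxBr mulmx1 mul1mx commP1.
have P0P : P0 *m P = P *m P0.
  by rewrite mulmxBl mulmxBr mulmx1 mul1mx P1P PP1.
have rr0 : mx_rep (fun x => P0 *m rho x).
  split=> [a x y|x y]; first by rewrite rl mulmxDr scalemxAr.
  rewrite rlie mulmxBr !mulmxA.
  by rewrite -(mulmxA P0 (rho y) P0) -(mulmxA P0 (rho x) P0) -!commP0 !mulmxA P0P0.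
have cl0 : linear (fun x => c x *m P0).
  by move=> a x y; rewrite cl mulmxDl scalemxAl.
have cc0 x y : c (lie x y) *m P0 =
    c y *m P0 *m (P0 *m rho x) - c x *m P0 *m (P0 *m rho y).
  by rewrite cc mulmxBl !(mulmxA _ P0) -!(mulmxA _ P0 P0) P0P0 -!mulmxA !commP0.
have [] := IH (fun x => P0 *m rho x) (fun x => c x *m P0) (P0 *m P) _ _ rr0 _ _ cl0 cc0.
(* If the rank did not drop, P would factor as X P0 P, and then P1 = P P1 = X P0 P1 = 0. *)
- apply: leq_trans rP; rewrite ltn_neqAle mxrankS ?submxMl// andbT.
  apply: contra P1_neq0 => /eqP rk.
  have : (P <= P0 *m P)%MS by rewrite -(mxrank_leqif_sup (submxMl _ _)).2 rk.
  case/submxP => X PX; rewrite -PP1 PX -!mulmxA PP1.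
  by rewrite mulmxBl mul1mx -[P1 *m P1]/(P1 * P1) P1P1 subrr mulmx0.
- by rewrite -mulmxA (mulmxA P) -P0P -mulmxA PP mulmxA P0P0.
- by move=> x; rewrite P0P -mulmxA (mulmxA P0) P0P0 mulmxA -P0P -mulmxA Prho.
- by move=> x; rewrite mulmxA -(mulmxA P0) -commP0 mulmxA P0P0 -mulmxA rhoP.
(* The first term yields c(x) Cas Q = c(x) P1 and the second, by induction, c(x) P0. *)
move=> m0 m0E; exists (m *m Q + m0 *m P0) => x.
rewrite mulmxDl -!mulmxA -m0E commQ mulmxA mE -mulmxA -[Cas *m Q]/(Cas * Q) CQ.
by rewrite -mulmxDr addrC subrK mulmx1.
Qed.

End TraceForm.

(** * Roots and highest weights *)

Section RootDecomposition.
Variables (C : numClosedFieldType) (g : vectLieAlgType C).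
Variable h : {vspace g}.
Hypothesis h_cartan : cartan_subalgebra h.

Lemma ad_diagonalizable_mx (x : g) :
  ad_diagonalizable x -> diagonalizable (act_mx (adjoint g) x).
Proof.
case=> b bb beig.
have bs : size b == dim g by rewrite -dimvf (size_basis (X := in_tuple b) bb).
pose bt := Tuple bs; have /freeP bfree : free bt by exact: basis_free bb.
pose P := \matrix_(i < dim g) v2r bt`_i.
have Pu : P \in unitmx.
  rewrite -row_free_unit -kermx_eq0; apply/eqP/row_matrixP => i; rewrite row0.
  have /(congr1 r2v) : row i (kermx P) *m P = 0 by rewrite -row_mul mulmx_ker row0.
  rewrite mulmx_sum_row linear_sum linear0 /= => E; apply/rowP => j; rewrite [RHS]mxE.
  apply: (bfree (fun j => row i (kermx P) 0 j)); rewrite -[RHS]E.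
  by apply: eq_bigr => k _; rewrite linearZ /= rowK v2rK.
exists P => //; apply/diagonalizable_forPex.
have /choice[a aE] (i : 'I_(dim g)) : exists a, lie x bt`_i = a *: bt`_i.
  by apply: beig; rewrite (_ : b = bt)// mem_nth ?size_tuple.
exists (\row_i a i); apply/(simmxP Pu)/row_matrixP => i.
rewrite row_mul rowK (act_mxE (W := adjoint g) x bt`_i) [act _ _]aE row_mul linearZ /=.
rewrite row_diag_mx mxE -scalemxAl -rowE rowK//.
Qed.

(** The operators ad t, for t in a basis of h, commute and are diagonalizable, hence are
    diagonalized together; the rows of the common eigenbasis are weight vectors. *)
Lemma root_span (U : {vspace g}) :
  (forall (a : weight h) x, in_root_space a x -> x \in U) -> U = fullv.
Proof.
have [habel _ hdiag] := h_cartan => HU.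
pose As := [seq act_mx (adjoint g) t | t <- vbasis h].
have : codiagonalizable As.
  apply/codiagonalizableP; split.
    move=> _ _ /mapP[t /vbasis_mem th ->] /mapP[s /vbasis_mem sh ->].
    apply/eqP; rewrite /comm_mx -subr_eq0 -act_mx_lie habel//.
    have := act_mxP (adjoint g) (-1) 0 0.
    by rewrite scaler0 addr0 scaleN1r addNr => ->.
  by move=> _ /mapP[t /vbasis_mem th ->]; apply/ad_diagonalizable_mx/hdiag.
case=> P Pu /allP PAs; pose x i : g := r2v (row i P).
have xU i : x i \in U.
  have x0 : x i != 0.
    apply/eqP => /(congr1 v2r); rewrite r2vK linear0 => r0.
    have := row_mul i P (invmx P); rewrite r0 mul0mx mulmxV// => /rowP/(_ i).
    by rewrite !mxE eqxx => /eqP; rewrite oner_eq0.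
  have line t : t \in h -> lie t (x i) \in <[x i]>%VS.
    move=> th; have [F FE] := lfun_of_linear (lie_linearl (x i)).
    rewrite -FE memv_preim; move: t th; apply/subvP.
    rewrite -(span_basis (vbasisP h)); apply/span_subvP => t tb.
    rewrite -memv_preim FE; have /PAs/= : act_mx (adjoint g) t \in As by apply: map_f.
    move=> /diagonalizable_forPex[D /(simmxP Pu)/(congr1 (row i))].
    rewrite row_mul -[row i P]r2vK (act_mxE (W := adjoint g) t (x i)) => /(canRL v2rK) E.
    apply/vlineP; exists (D 0 i); rewrite -[lie t (x i)]/(act t (x i : adjoint g)) E.
    by rewrite row_mul row_diag_mx -scalemxAl -rowE linearZ.
  have al : linear (fun t : subvs_of h => coord [tuple x i] 0 (lie (vsval t) (x i)) : C^o).
    by move=> k s t; rewrite linearP lie_linearl linearP.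
  have [a aE] := lfun_of_linear al.
  apply: (HU a) => t; rewrite aE; have /vlineP[k E] := line _ (subvsP t).
  have c1 : coord [tuple x i] 0 (x i) = 1.
    by have := coord_free 0 0 (X := [tuple x i]); rewrite seq1_free x0 /= => ->.
  rewrite E linearZ /= c1; congr (_ *: _); exact: (esym (mulr1 k)).
apply/vspaceP => y; rewrite memvf; have -> : y = \sum_i (v2r y *m invmx P) 0 i *: x i.
  apply: v2r_inj; rewrite linear_sum -[LHS](mulmxKV Pu) mulmx_sum_row.
  by apply: eq_bigr => i _; rewrite linearZ /= r2vK.
by apply: memv_suml => i _; apply/memvZ/xU.
Qed.

Variable D : seq (weight h).
Hypothesis D_base : is_root_base D.

(** Linear independence of D makes evaluation of the simple roots on h surjective. The value of a
    root at d is then its height. *)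
Lemma exists_level_element : exists d : subvs_of h, forall i : 'I_(size D), D`_i d = 1.
Proof.
have [Dbas _ _] := D_base.
have /freeP Dfree : free (in_tuple D) by exact: basis_free Dbas.
pose M := \matrix_(i < dim (subvs_of h), j < size D) (D`_j (std_basis i) : C).
have : row_full M.
  rewrite -[row_full M]/(\rank M == size D) -mxrank_tr -[_ == _]/(row_free M^T).
  rewrite -kermx_eq0; apply/eqP/row_matrixP => i; rewrite row0.
  have /rowP uM : row i (kermx M^T) *m M^T = 0 by rewrite -row_mul mulmx_ker row0.
  apply/rowP => j; rewrite [RHS]mxE; apply: (Dfree (fun j => row i (kermx M^T) 0 j)).
  apply/lfunP => t; rewrite sum_lfunE zero_lfunE.
  transitivity (\sum_(k < size D) \sum_l
      v2r t 0 l * (row i (kermx M^T) 0 k * M l k)).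
    apply: eq_bigr => k _; rewrite scale_lfunE {1}(std_basis_sum t) linear_sum scaler_sumr.
    by apply: eq_bigr => l _; rewrite linearZ /= [M l k]mxE; exact: mulrCA.
  rewrite exchange_big big1// => l _ /=; rewrite -mulr_sumr.
  rewrite (_ : \sum_k _ = 0) ?mulr0//; transitivity ((row i (kermx M^T) *m M^T) 0 l).
    by rewrite [RHS]mxE; apply: eq_bigr => k _; rewrite [M^T _ _]mxE.
  by rewrite uM mxE.
move=> /(submx_full (const_mx 1 : 'rV_(size D))) /submxP[u uM].
exists (r2v u) => j; have := congr1 (fun A : 'rV_(size D) => A 0 j) uM; rewrite !mxE => ->.
rewrite (std_basis_sum (r2v u)) linear_sum; apply: eq_bigr => i _.
by rewrite linearZ /= r2vK mxE.
Qed.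

Variable d : subvs_of h.
Hypothesis dP : forall i : 'I_(size D), D`_i d = 1.

Lemma nonneg_comb_level (a : weight h) : nonneg_comb D a -> a != 0 ->
  exists2 k : nat, (0 < k)%N & a d = k%:R.
Proof.
case=> n -> a0; exists (\sum_i n i)%N.
  rewrite lt0n; apply: contra a0; rewrite sum_nat_eq0 => /forallP n0.
  by apply/eqP/big1 => i _; rewrite (eqP (n0 i)) mulr0n.
rewrite sum_lfunE natr_sum; apply: eq_bigr => i _.
by rewrite -scaler_nat scale_lfunE dP [_ *: _]mulr1.
Qed.

Lemma root_space_cases (a : weight h) (x : g) : in_root_space a x -> x != 0 ->
  [\/ a = 0,
      positive_root D a |
      exists2 k : nat, (0 < k)%N & a d = - k%:R ].
Proof.
have [_ _ Dcomb] := D_base => ax x0; have [->|a0] := eqVneq a 0; first by constructor 1.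
have ra : is_root a by split=> //; exists x.
have [pa|na] := Dcomb a ra; first by constructor 2.
constructor 3; have [|k k0] := nonneg_comb_level na; first by rewrite oppr_eq0.
by rewrite opp_lfunE => E; exists k => //; rewrite -E opprK.
Qed.

Hypothesis g_simple : lie_simple g.

Lemma level_element_semisimple : real_semisimple (vsval d).
Proof.
split; last first.
  move=> U HU; apply: root_span => a x ax.
  have [->|x0] := eqVneq x 0; first exact: mem0v.
  apply: (HU (a d)) => //.
  have [->|[[a0 _] pa]|[k _ ->]] := root_space_cases ax x0.
  - by rewrite zero_lfunE rpred0.
  - by have [k _ ->] := nonneg_comb_level pa a0; apply: realn.
  - by rewrite rpredN realn.
have [habel hself _] := h_cartan; have [[x1 [y1 xy]] _] := g_simple.
have [_ Droot _] := D_base.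
(* With no simple roots every weight is 0, so g = h would be abelian; otherwise a simple root vector
   has eigenvalue 1. *)
case E : D => [|a D'].
  suff hfull : h = fullv by move: xy; rewrite habel ?hfull ?memvf ?eqxx.
  apply: root_span => a x ax; apply: hself => y yh.
  have [Dbas _ _] := D_base.
  have a0 : a = 0.
    have := memvf a; rewrite -(span_basis Dbas) E span_nil memv0 => /eqP//.
  by have := ax (vsproj h y); rewrite vsprojK// a0 zero_lfunE scale0r.
have aD : a \in D by rewrite E mem_head.
have [a0 [x x0 ax]] := Droot a aD.
exists x; rewrite ax scaler_eq0 negb_or x0 andbT.
have lt0 : (0 < size D)%N by rewrite E.
have := dP (Ordinal lt0); rewrite /= E /= => ->; exact: oner_neq0.
Qed.

End RootDecomposition.

(** * Generation from a highest weight vector, and comparison of weights *)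

Section HighestWeight.
Variables (C : numClosedFieldType) (g : vectLieAlgType C).
Variable h : {vspace g}.
Hypothesis h_cartan : cartan_subalgebra h.
Variable D : seq (weight h).
Hypothesis D_base : is_root_base D.
Variable d : subvs_of h.
Hypothesis dP : forall i : 'I_(size D), D`_i d = 1.

Definition lowering (x : g) := exists2 a : weight h, in_root_space a x &
  exists2 k : nat, (0 < k)%N & a d = - k%:R.

(** This replaces V = U(n^-) v, without the enveloping algebra. If U is not a submodule, the smaller
    space U' satisfies the same hypotheses: root spaces send v into U, and y x u = x y u + [y, x] u
    keeps U' stable under lowering x. *)
Lemma highest_weight_generate (V : lieModule g) l v (U : {vspace V}) :
  simple_module V -> highest_weight_vector D l v -> v \in U ->
  (forall x u, lowering x -> u \in U -> act x u \in U) -> U = fullv.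
Proof.
move=> [_ Vsimple] [v0 vwt vpos].
have [n] := ubnP (\dim U); elim: n => // n IH in U *; rewrite ltnS => dU vU Ulow.
have [Usub|] := pselect (submodule U).
  have [U0|//] := Vsimple U Usub.
  by move: vU v0; rewrite U0 memv0 => /eqP->; rewrite eqxx.
(* Shrink U to the largest subspace U' of U sent into U by all of g.           *)
have [F FE] : exists F : g -> 'Hom(V, V), forall x u, F x u = act x u.
  have H x : exists F : 'Hom(V, V), forall u, F u = act x u.
    exact/lfun_of_linear/act_linearr.
  by have [F FE] := choice H; exists F.
pose U' := (U :&: \bigcap_(i < dim g) (F (std_basis i) @^-1: U))%VS.
have U'P u : u \in U' <-> u \in U /\ forall x, act x u \in U.
  split=> [/memv_capP[uU]|[uU xu]].
    rewrite memvE => /subv_bigcapP H; split=> // x.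
    have [G GE] := lfun_of_linear (act_linearl u).
    rewrite -GE (std_basis_sum x) linear_sum; apply: memv_suml => i _.
    rewrite linearZ /= GE; apply: memvZ.
    by have := H i isT; rewrite -memvE -memv_preim FE.
  apply/memv_capP; split=> //; rewrite memvE; apply/subv_bigcapP => i _.
  by rewrite -memvE -memv_preim FE.
move=> nsub; suff U'f : U' = fullv.
  by apply/vspaceP => u; rewrite memvf; have /U'P[] : u \in U' by rewrite U'f memvf.
apply: IH.
- apply: leq_trans dU; rewrite ltn_neqAle dimvS ?capvSl// andbT.
  rewrite (dimv_leqif_eq (capvSl _ _)).2; apply/eqP => UU'; apply: nsub => x u uU.
  by move: uU; rewrite -{1}UU' => /U'P[].
- apply/U'P; split=> // x; have [G GE] := lfun_of_linear (act_linearl v).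
  rewrite -GE memv_preim; rewrite (root_span h_cartan (U := (G @^-1: U)%VS)) ?memvf// => a y ay.
  rewrite -memv_preim GE.
  have [->|y0] := eqVneq y 0; first by rewrite act0l mem0v.
  have [a0|pa|na] := root_space_cases D_base dP ay y0.
  + have [_ hself _] := h_cartan.
    have yh : y \in h.
      by apply: hself => z zh; have := ay (vsproj h z); rewrite vsprojK// a0 zero_lfunE scale0r.
    by have := vwt (vsproj h y); rewrite vsprojK// => ->; apply: memvZ.
  + by rewrite (vpos _ _ pa ay) mem0v.
  + by apply: Ulow => //; exists a.
- move=> x u xlow /U'P[uU gu]; apply/U'P; split=> [|y]; first exact: gu.
  have -> : act y (act x u) = act x (act y u) + act (lie y x) u.
    by rewrite act_lie addrC subrK.
  by apply: memvD => //; apply: Ulow.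
Qed.

(* xi is an eigenvector of the transpose of d whose eigenvalue has maximal     *)
(* real part: lowering elements increase that eigenvalue.                      *)
Lemma lowering_coinvariant (W : lieModule g) : (fullv : {vspace W}) <> 0%VS ->
  exists2 xi : 'Hom(W, C^o), xi != 0 & forall x w, lowering x -> xi (act x w) = 0.
Proof.
move=> W0; have [n dW] : exists n, dim W = n.+1.
  case E : (dim W) => [|n]; last by exists n.
  by case: W0; apply/eqP; rewrite -dimv_eq0 dimvf E.
have colF (q : 'cV[C]_(dim W)) : exists xi : 'Hom(W, C^o), forall w, xi w = (v2r w *m q) 0 0.
  by apply: lfun_of_linear => k u w; rewrite linearP mulmxDl -scalemxAl !mxE.
suff [q q0 qlow] : exists2 q : 'cV[C]_(dim W), q != 0 &
    forall x, lowering x -> act_mx W x *m q = 0.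
  have [xi xiE] := colF q; exists xi => [|x w xl]; last first.
    by rewrite xiE -act_mxE -mulmxA qlow// mulmx0 mxE.
  apply: contra q0 => /eqP xi0; apply/eqP/matrixP => i j.
  have := xiE (std_basis i); rewrite xi0 zero_lfunE /std_basis r2vK -rowE !mxE ord1.
  by move=> <-.
pose A := act_mx W (vsval d).
have low x : lowering x -> exists2 k : C, 0 < k &
    A *m act_mx W x = act_mx W x *m A + k *: act_mx W x.
  move=> [a ax [k k0 ad]]; exists k%:R; first by rewrite ltr0n.
  have := act_mx_lie W (vsval d) x; rewrite ax ad scaleNr.
  have -> : act_mx W (- (k%:R *: x)) = - (k%:R *: act_mx W x).
    have [F FE] := lfun_of_linear (act_mxP W).
    by rewrite -!FE linearN linearZ.
  by move=> E; rewrite -[k%:R *: _]opprK E opprB addrC subrK.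
move: (A) (act_mx W) low; rewrite dW => {}A rho low.
have [e [eA _]] := spectrum_exists A^T.
have ereal i : 'Re (e i) \is Num.real by apply: Creal_Re.
pose i0 := [arg max_(i > ord0 | true) 'Re (e i)]%O.
have i0P j : 'Re (e j) <= 'Re (e i0).
  by rewrite /i0; case: real_arg_maxP => // i _ /(_ j isT).
have eigE a : eigenvalue A^T a -> exists j, a = e j.
  rewrite eigenvalue_root_char eA rootE horner_prod prodf_seq_eq0 => /hasP[j _].
  by rewrite hornerXsubC subr_eq0 => /eqP->; exists j.
have : eigenvalue A^T (e i0).
  by rewrite eigenvalue_root_char eA rootE horner_prod (bigD1 i0)//= hornerXsubC subrr mul0r.
case/eigenvalueP => q qA q0; exists q^T => [|x xl].
  by apply: contra q0 => /eqP q0; rewrite -[q]trmxK q0 trmx0.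
have [k k0 Ax] := low x xl; apply/eqP/negPn/negP => xq.
have [|j ej] := eigE (e i0 + k).
  apply/eigenvalueP; exists (rho x *m q^T)^T; last first.
    by apply: contra xq => /eqP xq; rewrite -[_ *m _]trmxK xq trmx0.
  rewrite -trmx_mul mulmxA Ax mulmxDl -mulmxA -[A]trmxK -trmx_mul qA.
  by rewrite [(e i0 *: q)^T]linearZ /= -scalemxAr -scalemxAl -scalerDl linearZ.
have := i0P j; rewrite -ej raddfD /= (Creal_ReP k _) ?gtr0_real//.
by rewrite gerDl => /(lt_le_trans k0); rewrite ltxx.
Qed.

Lemma weight_equivariant_eq0 (V W : lieModule g) (l m : weight h)
    (phi : g -> 'Hom(V, W)) :
  is_simple_hw D l V -> is_simple_hw D m W -> linear phi ->
  (forall x y v, phi (lie x y) v = act x (phi y v) - phi y (act x v)) ->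
  ~ (is_root (m - l) \/ m - l = 0) -> forall x, phi x = 0.
Proof.
move=> [Vs [v vhw]] [Ws [w whw]] phil phiE ncov.
have [W0 Wsub] := Ws; have [xi xi0 xilow] := lowering_coinvariant W0.
have [_ vwt _] := vhw; have [_ wwt _] := whw.
have [Phi PhiE] := lfun_of_linear phil.
(* [xi] has weight m for all of h: the identity holds at [w], and both sides vanish on the image of
   a lowering x because [t, x] is a multiple of x. *)
have xiwt t u : xi (act (vsval t) u) = m t * xi u.
  have [F FE] : exists F : 'Hom(W, C^o), forall u, F u = xi (act (vsval t) u) - m t * xi u.
    apply: lfun_of_linear => k a b; rewrite !linearP /= mulrDr scalerBr opprD addrACA.
    by congr (_ - _ + _); exact: mulrCA.
  suff : u \in lker F by rewrite memv_ker FE subr_eq0 => /eqP.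
  rewrite (highest_weight_generate Ws whw (U := lker F)) ?memvf//.
    by rewrite memv_ker FE wwt linearZ subrr.
  move=> x a xl _; rewrite memv_ker FE (xilow x a xl) mulr0 subr0.
  have [b bx bd] := xl; have := act_lie (vsval t) x a; rewrite bx.
  have [G GE] := lfun_of_linear (act_linearl a).
  rewrite -GE linearZ /= GE => /eqP; rewrite eq_sym subr_eq => /eqP->.
  by rewrite linearD linearZ /= !xilow// scaler0 addr0.
have phi_kill x u : xi (phi x u) = 0.
  have ker_phi u' : (forall (a : weight h) y, in_root_space a y -> xi (phi y u') = 0) ->
      forall y, xi (phi y u') = 0.
    move=> H y; have [F FE] : exists F : 'Hom(g, C^o), forall y, F y = xi (phi y u').
      by apply: lfun_of_linear => k a b; rewrite phil add_lfunE scale_lfunE linearP.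
    suff : y \in lker F by rewrite memv_ker FE => /eqP.
    rewrite (root_span h_cartan (U := lker F)) ?memvf// => a z az.
    by rewrite memv_ker FE (H a).
  have [F FE] : exists F : g -> 'Hom(V, C^o), forall y u, F y u = xi (phi y u).
    have H y : exists F : 'Hom(V, C^o), forall u, F u = xi (phi y u).
      by apply: lfun_of_linear => k a b; rewrite !linearP.
    by have [F FE] := choice H; exists F.
  (* N is stable under lowering by equivariance and the choice of [xi], so it suffices that it
     contains the highest weight vector [v]. *)
  pose N := (\bigcap_(i < dim g) lker (F (std_basis i)))%VS.
  have NP z : z \in N <-> forall y, xi (phi y z) = 0.
    split=> [|H].
      rewrite memvE => /subv_bigcapP zN y.
      rewrite -PhiE (std_basis_sum y) linear_sum sum_lfunE linear_sum big1// => i _ /=.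
      rewrite linearZ scale_lfunE linearZ /= PhiE.
      by have := zN i isT; rewrite -memvE memv_ker FE => /eqP->; rewrite scaler0.
    rewrite memvE; apply/subv_bigcapP => i _.
    by rewrite -memvE memv_ker FE H.
  suff Nf : N = fullv by have /NP : u \in N by rewrite Nf memvf.
  apply: (highest_weight_generate Vs vhw) => [|y z yl /NP zN]; apply/NP; last first.
    move=> a; have := phiE y a z => /eqP; rewrite eq_sym subr_eq => /eqP.
    move/(congr1 xi); rewrite xilow// linearD /= zN add0r => <-//.
  apply: ker_phi => a y ay.
  have [->|y0] := eqVneq y 0; first by rewrite -PhiE linear0 zero_lfunE linear0.
  apply/eqP/negPn/negP => xi_neq0; apply: ncov.
  have aE : m - l = a.
    apply/lfunP => t; rewrite add_lfunE opp_lfunE.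
    have := phiE (vsval t) y v; rewrite ay vwt.
    rewrite -PhiE linearZ /= scale_lfunE PhiE linearZ /=.
    move/(congr1 xi); rewrite linearB /= xiwt !linearZ /= scalerN => E.
    apply: (mulIf xi_neq0); rewrite mulrBl; exact: esym E.
  rewrite aE; have [->|a0] := eqVneq a 0; first by right.
  by left; split=> //; exists y.
move=> x; apply/lfunP => u; rewrite zero_lfunE.
(* The values of phi span a submodule inside the kernel of [xi], hence a proper one, hence 0. *)
pose S := <<[seq phi (std_basis i) (std_basis j) | i <- enum 'I_(dim g), j <- enum 'I_(dim V)]>>%VS.
have Sphi y z : phi y z \in S.
  rewrite -PhiE (std_basis_sum y) linear_sum sum_lfunE; apply: memv_suml => i _ /=.
  rewrite linearZ scale_lfunE /= PhiE; apply: memvZ.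
  rewrite (std_basis_sum z) linear_sum; apply: memv_suml => j _.
  rewrite linearZ; apply/memvZ/memv_span.
  by apply/allpairsP; exists (i, j); rewrite !mem_enum.
have Sgen (U : {vspace W}) : (forall y z, phi y z \in U) -> (S <= U)%VS.
  by move=> H; apply/span_subvP => _ /allpairsP[[i j] [_ _ ->]].
have Ssub : submodule S.
  move=> y z; have [F FE] := lfun_of_linear (act_linearr (l := W) y).
  rewrite -FE memv_preim; apply/subvP/Sgen => a b; rewrite -memv_preim FE.
  have -> : act y (phi a b) = phi (lie y a) b + phi a (act y b) by rewrite phiE subrK.
  exact: memvD.
have [S0|Sf] := Wsub S Ssub; first by have := Sphi x u; rewrite S0 memv0 => /eqP.
have : (S <= lker xi)%VS by apply: Sgen => y z; rewrite memv_ker phi_kill.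
rewrite Sf => /subvP Sxi; case/negP: xi0; apply/eqP/lfunP => z.
by apply/eqP; rewrite zero_lfunE -memv_ker Sxi ?memvf.
Qed.

End HighestWeight.

(** * Extensions and cocycles *)

Section CurrentAlgebra.
Variables (K : numFieldType) (g : lieAlgType K).
Implicit Types (x y : g) (k l : nat).

Lemma tmonE x k n : tmon x k n = if n == k then x else 0.
Proof. by []. Qed.

Lemma tmon_linear k : linear (fun x : g => tmon x k).
Proof.
move=> a x y; apply: current_eqP => n; rewrite coeftD coeftZ !tmonE.
by case: eqP; rewrite // scaler0 addr0.
Qed.

Lemma lie_tmon x y k l : lie (tmon x k) (tmon y l) = tmon (lie x y) (k + l).
Proof.
apply: current_eqP => n; rewrite [LHS]current_lieE tmonE.
have [lt_kn|le_nk] := leqP k n; last first.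
  rewrite big1 => [|i _]; first by rewrite ltn_eqF// (leq_trans le_nk)// leq_addr.
  by rewrite tmonE ltn_eqF ?lie0l// (leq_ltn_trans _ le_nk)// -ltnS.
rewrite (bigD1 (Ordinal (lt_kn : (k < n.+1)%N)))//= eqxx big1 ?addr0.
  rewrite -{2}(subnKC lt_kn) eqn_add2l.
  by case: eqP => // _; rewrite linear0.
move=> i; rewrite -[i == k :> nat]/(i == Ordinal (lt_kn : (k < n.+1)%N)) => /negbTE->.
by rewrite lie0l.
Qed.

Lemma current_sum (a : current g) : exists N, a = \sum_(k < N) tmon (a k) k.
Proof.
have /asboolP[N aN] := coeftP a; exists N; apply: current_eqP => n.
have -> : (\sum_(k < N) tmon (a k) k) n = \sum_(k < N) tmon (a k) k n.
  by apply: (big_morph (fun b : current g => coeft b n)) => [b c|]; rewrite ?coeftD ?coeft0.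
have [le_Nn|lt_nN] := leqP N n.
  by rewrite aN// big1// => k _; rewrite tmonE gtn_eqF// (leq_trans _ le_Nn).
rewrite (bigD1 (Ordinal lt_nN))//= eqxx big1 ?addr0// => k kn.
by rewrite eq_sym -[k == n :> nat]/(k == Ordinal lt_nN) (negPf kn).
Qed.

Lemma lmod_hom_tmon (M N : lieModule (current g)) (f : 'Hom(M, N)) :
  (forall x k v, f (act (tmon x k) v) = act (tmon x k) (f v)) -> is_lmod_hom f.
Proof.
move=> H a v; have [n ->] := current_sum a.
have act_sum (P : lieModule (current g)) (p : P) :
    act (\sum_(k < n) tmon (a k) k) p = \sum_(k < n) act (tmon (a k) k) p.
  apply: (big_morph (act^~ p)) => [b c|]; last exact: act0l.
  by have := act_linearl p 1 b c; rewrite !scale1r.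
by rewrite !act_sum linear_sum; apply: eq_bigr => k _; apply: H.
Qed.

Lemma deg_disjoint (E : grModule g) i j (v : E) :
  v \in deg E i -> v \in deg E j -> i != j -> v = 0.
Proof.
have [N [degN /directv_sum_independent ind _]] := deg_sum E => vi vj ij.
have [le_Ni|lt_iN] := leqP N i; first by apply/eqP; rewrite -memv0 -(degN i).
have [le_Nj|lt_jN] := leqP N j; first by apply/eqP; rewrite -memv0 -(degN j).
pose u (k : 'I_N) := if k == i :> nat then v else if k == j :> nat then - v else 0.
have ud (k : 'I_N) : true -> u k \in deg E k.
  by rewrite /u; case: eqP => [->//|_]; case: eqP => [->|_]; rewrite ?memvN ?mem0v.
have us : \sum_k u k = 0.
  rewrite (bigD1 (Ordinal lt_iN))//= (bigD1 (Ordinal lt_jN)) /=; last first.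
    by rewrite -val_eqE /= eq_sym.
  rewrite big1 => [|k /andP[ki kj]].
    by rewrite addr0 /u /= !eqxx eq_sym (negPf ij) subrr.
  by rewrite /u (negPf (ki : nat_of_ord k != i)) (negPf (kj : nat_of_ord k != j)).
by have := ind u ud us (Ordinal lt_iN) isT; rewrite /u /= eqxx.
Qed.

End CurrentAlgebra.

Section ExtensionSection.
Variables (K : numFieldType) (g : vectLieAlgType K) (V W : lieModule g).
Variables (r s : nat) (E : extension (ev_gr V r) (ev_gr W s)).
Let i := ext_inc E.
Let p := ext_prj E.

Lemma ext_incK : cancel i (i^-1)%VF.
Proof. by apply: lker0_lfunK; rewrite ext_inj. Qed.

Lemma ext_incVK e : p e = 0 -> i ((i^-1)%VF e) = e.
Proof. by move=> pe0; apply: limg_lfunVK; rewrite ext_exact memv_ker pe0. Qed.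

Lemma ext_prj_inc w : p (i w) = 0.
Proof. by apply/eqP; rewrite -memv_ker -ext_exact memv_img ?memvf. Qed.

Lemma ext_inc_deg w : i w \in deg E s.
Proof. by apply: (ext_inc_hom E).2; rewrite /= /ev_deg eqxx memvf. Qed.

Lemma ext_prj_deg j e : e \in deg E j -> j != r -> p e = 0.
Proof.
move=> /(ext_prj_hom E).2 /= + jr; rewrite /ev_deg (negPf jr) memv0.
by move/eqP.
Qed.

(** All degrees of E other than r map to 0, so the degree r part alone already maps onto V. *)
Lemma ext_section : exists sigma : 'Hom(V, E),
  (forall v, p (sigma v) = v) /\ (forall v, sigma v \in deg E r).
Proof.
pose p' := (p \o projv (deg E r))%VF.
have p'f : limg p' = fullv.
  rewrite limg_comp limg_proj; apply/eqP; rewrite eqEsubv subvf /= -(ext_surj E).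
  have [N [_ _ <-]] := deg_sum E.
  rewrite limg_sum; apply/subv_sumP => j _; have [->|jr] := eqVneq (j : nat) r.
    exact: subvv.
  apply/subvP => _ /memv_imgP[e ej ->].
  by have -> := ext_prj_deg ej jr; apply: mem0v.
exists (projv (deg E r) \o p'^-1)%VF; split=> v; rewrite comp_lfunE ?memv_proj//.
have : p' ((p'^-1)%VF v) = v by apply: limg_lfunVK; rewrite p'f memvf.
by rewrite comp_lfunE.
Qed.

Lemma ext_split_tmon (sigma : 'Hom(V, E)) :
  (forall v, p (sigma v) = v) -> (forall v, sigma v \in deg E r) ->
  (forall x k v, act (tmon x k) (sigma v) = sigma (ev_act (tmon x k) v)) ->
  ext_split E.
Proof.
move=> ps sd sact; exists sigma; split=> //; split.
  by apply: lmod_hom_tmon => x k v; rewrite sact.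
move=> j v; rewrite /= /ev_deg; case: eqP => [-> _|_]; first exact: sd.
by rewrite memv0 => /eqP->; rewrite linear0 mem0v.
Qed.

Variable sigma : 'Hom(V, E).
Hypothesis prj_sigma : forall v, p (sigma v) = v.
Hypothesis sigma_deg : forall v, sigma v \in deg E r.

(** The defect of [sigma] is killed by [p], hence comes from W. On x t^k it has degree r + k,
    whereas the image of W has degree s. *)
Lemma ext_cocycle : exists c : current g -> 'Hom(V, W),
  [/\ forall a v, i (c a v) = act a (sigma v) - sigma (ev_act a v),
      linear c,
      forall a b v, c (lie a b) v =
        (ev_act a (c b v) - ev_act b (c a v)) + (c a (ev_act b v) - c b (ev_act a v)) &
      forall x k, (r + k != s)%N -> c (tmon x k) = 0].
Proof.
have H a : exists F : 'Hom(V, W), forall v, F v = (i^-1)%VF (act a (sigma v) - sigma (ev_act a v)).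
  apply: lfun_of_linear => k u v; rewrite (linearP sigma) (linearP (act a)) ev_act_linearr.
  by rewrite linearP /= opprD addrACA -scalerBr linearP.
have [c cE] := choice H.
have icE a v : i (c a v) = act a (sigma v) - sigma (ev_act a v).
  rewrite cE ext_incVK// linearB /= prj_sigma (ext_prj_hom E).1 -/p prj_sigma.
  exact: subrr.
exists c; split=> //.
- move=> k a b; apply/lfunP => v; rewrite add_lfunE scale_lfunE.
  apply: (can_inj ext_incK); rewrite linearP /= !icE.
  rewrite (act_linearl (sigma v) k a b) (ev_act_linearl v k a b) linearP /=.
  by rewrite opprD addrACA scalerBr.
- move=> a b v; apply: (can_inj ext_incK).
  have iact c' (w : W) : i (ev_act c' w) = act c' (i w : E) by rewrite (ext_inc_hom E).1.
  have AC (Z : zmodType) (x y m n t q : Z) :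
      x - y - (t - q) = (x - m - (y - n)) + ((m - t) - (n - q)).
    have T a' b' c' : a' - b' + (b' - c') = a' - c' :> Z by rewrite addrA addrNK.
    have -> : x - m - (y - n) + (m - t - (n - q)) = x - t - (y - q).
      by rewrite -(T x m t) -(T y n q) [in RHS](opprD (y - n)) addrACA.
    by rewrite !opprB [q - t]addrC addrACA [- y + q]addrC.
  rewrite (linearD i) !(linearB i) /= !iact !icE act_lie ev_act_lie.
  rewrite (linearB sigma) (linearB (act a)) (linearB (act b)).
  exact: AC.
- move=> x k rks; apply/lfunP => v; rewrite zero_lfunE; apply: (can_inj ext_incK).
  rewrite linear0; apply: (@deg_disjoint _ _ E (r + k) s) => //; last exact: ext_inc_deg.
  rewrite icE; apply: memvB; first by apply: deg_act.
  case: k {rks} => [|k]; first by rewrite addn0.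
  have -> : ev_act (tmon x k.+1) v = 0 by rewrite /ev_act tmonE act0l.
  by rewrite linear0 mem0v.
Qed.

End ExtensionSection.

(** * The module of linear maps between two modules *)

Section HomModule.
Variables (K : fieldType) (L : lieAlgType K) (V W : lieModule L).

Definition hom_act (x : L) (f : 'Hom(V, W)) : 'Hom(V, W) :=
  (linfun (act x) \o f)%VF - (f \o linfun (act x))%VF.

Lemma hom_actE x f v : hom_act x f v = act x (f v) - f (act x v).
Proof. by rewrite /hom_act add_lfunE opp_lfunE !comp_lfunE !lfunE. Qed.

Lemma hom_act_linearl f : linear (hom_act^~ f).
Proof.
move=> k x y; apply/lfunP => v; rewrite [RHS]add_lfunE [in RHS]scale_lfunE !hom_actE.
by rewrite !act_linearl linearP scalerBr opprD addrACA.
Qed.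

Lemma hom_act_linearr x : linear (hom_act x).
Proof.
move=> k f f'; apply/lfunP => v.
rewrite [RHS]add_lfunE [in RHS]scale_lfunE !hom_actE !add_lfunE !scale_lfunE.
by rewrite linearP scalerBr opprD addrACA.
Qed.

Lemma hom_act_lie x y f :
  hom_act (lie x y) f = hom_act x (hom_act y f) - hom_act y (hom_act x f).
Proof.
apply/lfunP => v; rewrite [RHS]add_lfunE [in RHS]opp_lfunE !hom_actE !act_lie.
rewrite (linearB f) (linearB (act x)) (linearB (act y)) /=.
have T (a b c : W) : a - b + (b - c) = a - c by rewrite addrA addrNK.
have AC (a b p q m n : W) :
    a - b - (p - q) = (a - m - (n - q)) - (b - n - (m - p)).
  have -> : a - b - (p - q) = (a - p) - (b - q).
    by rewrite !opprB [q - p]addrC addrACA [- b + q]addrC.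
  rewrite -(T a m p) -(T b n q) (opprD (b - n)) (opprD _ (- (m - p))) opprK.
  by rewrite [- (b - n) - _]addrC addrACA [m - p + _]addrC.
exact: AC.
Qed.

Definition hom_module : lieModule L :=
  LieModule hom_act_linearl hom_act_linearr hom_act_lie.

End HomModule.

(** * Splitting of extensions when s is not r + 1 *)

Section Cohomology.
Variables (C : numClosedFieldType) (g : vectLieAlgType C).
Hypothesis g_simple : lie_simple g.
Variable d : g.
Hypothesis d_ss : real_semisimple d.

Lemma act_mx_rep (M : lieModule g) : mx_rep (act_mx M).
Proof. by split; [apply: act_mxP | apply: act_mx_lie]. Qed.

Lemma module_cocycle_coboundary (M : lieModule g) (c : g -> M) : linear c ->
  (forall x y, c (lie x y) = act x (c y) - act y (c x)) ->
  exists m, forall x, c x = act x m.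
Proof.
move=> cl cc; have [] := @cocycle_coboundary _ _ g_simple _ d_ss _ (act_mx M) (v2r \o c).
- exact: act_mx_rep.
- by move=> k x y; rewrite /= cl linearP.
- by move=> x y; rewrite /= cc linearB !act_mxE.
move=> m mE; exists (r2v m) => x; apply: v2r_inj.
by rewrite -act_mxE r2vK -mE.
Qed.

Variables V W : lieModule g.

Lemma ext1_nonadjacent r s : s <> r.+1 -> Ext1_zero (ev_gr V r) (ev_gr W s).
Proof.
move=> sr1 E; have [sigma [ps sd]] := ext_section E.
have [c [icE cl cc c0]] := ext_cocycle ps sd.
have ckl k : linear (fun x : g => c (tmon x k)).
  by move=> a x y; rewrite tmon_linear cl.
have iact a (w : W) : ext_inc E (ev_act a w) = act a (ext_inc E w : E).
  by rewrite (ext_inc_hom E).1.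
have [sr|sr] := eqVneq s r; last first.
  suff ck0 x k : c (tmon x k) = 0.
    apply: (ext_split_tmon ps sd) => x k v; apply/eqP.
    by rewrite -subr_eq0 -icE ck0 zero_lfunE linear0.
  have [rk|] := eqVneq (r + k)%N s; last exact: c0.
  have [m km] : exists m, k = m.+2.
    case: k rk => [|[|k]] rk; last by exists k.
      by move/eqP: sr; rewrite -rk addn0.
    by case: sr1; rewrite -rk addn1.
  apply: (simple_linear0 g_simple (ckl k)) => y z.
  (* Both exponents differ from k = s - r, so c vanishes on each factor. *)
  have -> : tmon (lie y z) k = lie (tmon y 1) (tmon z m.+1) by rewrite lie_tmon km add1n.
  have y1 : c (tmon y 1) = 0 by apply: c0; rewrite -rk km eqn_add2l.
  have z1 : c (tmon z m.+1) = 0 by apply: c0; rewrite -rk km eqn_add2l eqn_leq ltnn andbF.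
  apply/lfunP => v; rewrite cc y1 z1 !zero_lfunE /ev_act !linear0.
  by rewrite ?subr0 !addr0.
have ev0 (M : lieModule g) x v : ev_act (V := M) (tmon x 0) v = act x v by [].
have evS (M : lieModule g) x k v : ev_act (V := M) (tmon x k.+1) v = 0.
  by rewrite /ev_act tmonE act0l.
have [x y|T TE] := module_cocycle_coboundary (M := hom_module V W) (ckl 0).
  apply/lfunP => v; rewrite [RHS]add_lfunE [in RHS]opp_lfunE [act x _]/= [act y _]/=.
  rewrite !hom_actE.
  have -> : tmon (lie x y) 0 = lie (tmon x 0) (tmon y 0) by rewrite lie_tmon.
  by rewrite cc !ev0 opprB [X in _ = _ + X]addrC [RHS]addrACA [X in _ = _ + X]addrC.
have s'E v : (sigma - (ext_inc E \o T)%VF) v = sigma v - ext_inc E (T v).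
  by rewrite add_lfunE opp_lfunE comp_lfunE.
apply: (@ext_split_tmon _ _ _ _ _ _ _ (sigma - (ext_inc E \o T)%VF)).
- by move=> v; rewrite s'E linearB /= ext_prj_inc subr0 ps.
- move=> v; rewrite s'E; apply: memvB; first exact: sd.
  (* The type of E mentions both r and s, so the equation between them is transported through a
     fresh index j. *)
  suff degj j : s = j -> ext_inc E (T v) \in deg E j by apply: degj.
  by move=> <-; apply: ext_inc_deg.
move=> x k v; rewrite !s'E linearB /= -iact.
have -> : act (tmon x k) (sigma v) =
    ext_inc E (c (tmon x k) v) + sigma (ev_act (tmon x k) v) by rewrite icE subrK.
case: k => [|k]; last first.
  by rewrite !evS !linear0 c0 ?zero_lfunE ?linear0 ?addr0// sr -{2}[r]addn0 eqn_add2l.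
rewrite !ev0 TE [act x T]/= hom_actE linearB /=.
by rewrite addrAC [X in X + _]addrAC subrr add0r addrC.
Qed.

End Cohomology.

(** * Extensions from equivariant maps *)

Section TwistedSum.
Variables (K : numFieldType) (g : vectLieAlgType K) (V W : lieModule g).
Variable phi : g -> 'Hom(V, W).
Hypothesis phil : linear phi.
Hypothesis phiE : forall x y v, phi (lie x y) v = act x (phi y v) - phi y (act x v).
Variable r : nat.

(** The extension attached to phi: g acts diagonally, x t sends V to W by phi x, and higher powers
    of t act by 0. *)
Definition twist_act (a : current g) (u : W * V) : W * V :=
  (act (a 0%N) u.1 + phi (a 1%N) u.2, act (a 0%N) u.2).

Lemma twist_act_linearl u : linear (twist_act^~ u).
Proof.
move=> k a b; rewrite /twist_act !coeftD !coeftZ !act_linearl phil.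
by rewrite [(_ + phi (b 1%N)) _]add_lfunE scale_lfunE addrACA -scalerDr.
Qed.

Lemma twist_act_linearr a : linear (twist_act a).
Proof. by move=> k u v; rewrite /twist_act /= !linearP addrACA -scalerDr. Qed.

Lemma twist_act_lie a b u :
  twist_act (lie a b) u = twist_act a (twist_act b u) - twist_act b (twist_act a u).
Proof.
have l0 : lie a b 0%N = lie (a 0%N) (b 0%N) by rewrite [LHS]big_ord1.
have l1 : lie a b 1%N = lie (a 0%N) (b 1%N) - lie (b 0%N) (a 1%N).
  by rewrite [LHS]big_ord_recr big_ord1 /= (lie_skew (a 1%N)).
rewrite /twist_act l0 l1 !act_lie; congr (_, _) => /=.
have [Phi PhiE] := lfun_of_linear phil.
rewrite -PhiE linearB /= !PhiE add_lfunE opp_lfunE !phiE.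
rewrite (linearD (act (a 0%N))) (linearD (act (b 0%N))) /=.
have AC (p q m n s t : W) : p - q + (m - n - (t - s)) = p + m + s - (q + t + n).
  rewrite -[p + m + s]addrA -[q + t + n]addrA (opprD q) [RHS]addrACA.
  by congr (_ + _); rewrite opprB addrACA [- n - t]addrC -opprD.
exact: AC.
Qed.

Definition twist_lmod : lieModule (current g) :=
  LieModule twist_act_linearl twist_act_linearr twist_act_lie.

(** The kernel of the first projection is the copy of V, in degree r; that of the second is the copy
    of W, in degree r + 1. *)
Definition twist_deg (j : nat) : {vspace twist_lmod} :=
  if j == r then lker (linfun (fst : W * V -> W))
  else if j == r.+1 then lker (linfun (snd : W * V -> V)) else 0%VS.

Lemma twist_deg0 (u : W * V) : (u \in twist_deg r) = (u.1 == 0).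
Proof. by rewrite /twist_deg eqxx memv_ker lfunE. Qed.

Lemma twist_deg1 (u : W * V) : (u \in twist_deg r.+1) = (u.2 == 0).
Proof. by rewrite /twist_deg gtn_eqF// eqxx memv_ker lfunE. Qed.

Lemma twist_degN j (u : W * V) : u \in twist_deg j -> j != r -> j != r.+1 -> u = 0.
Proof.
move=> + /negPf jr /negPf jr1; rewrite /twist_deg jr jr1 memv0.
by move/eqP.
Qed.

Lemma twist_deg_sum : exists N : nat,
  [/\ forall j, (N <= j)%N -> twist_deg j = 0%VS,
      directv (\sum_(j < N) twist_deg j) &
      (\sum_(j < N) twist_deg j)%VS = fullv].
Proof.
exists r.+2; split.
- by move=> j rj; rewrite /twist_deg !gtn_eqF// ltnW.
- apply/directv_sum_independent => us usd; rewrite !big_ord_recr big1 /=; last first.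
    move=> j _; apply: (twist_degN (usd _ isT)); first by rewrite /= ltn_eqF.
    by rewrite /= ltn_eqF// ltnS ltnW.
  rewrite add0r; set a := widen_ord _ _; set b := ord_max => us0.
  have /= ua := usd a isT; have /= ub := usd b isT.
  rewrite twist_deg0 in ua; rewrite twist_deg1 in ub.
  have [za zb] : us a = 0 /\ us b = 0.
    move: (us a) (us b) us0 ua ub => [w0 v0] [w1 v1] [w01 v01] /eqP/= w00 /eqP/= v10.
    by move: w01 v01; rewrite w00 v10 add0r addr0 => -> ->.
  move=> i _; have [ir|ir] := eqVneq (i : nat) r.
    by rewrite (_ : i = a) //; apply: val_inj.
  have [ir1|ir1] := eqVneq (i : nat) r.+1.
    by rewrite (_ : i = b) //; apply: val_inj.
  exact: (twist_degN (usd i isT)).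
apply/vspaceP => -[w v]; rewrite memvf.
have -> : (w, v) = (0, v) + (w, 0) :> W * V.
  by apply: injective_projections; rewrite /= ?addr0 ?add0r.
have le1 : (r < r.+2)%N by [].
apply: memvD.
  rewrite memvE (sumv_sup (Ordinal le1))// -memvE twist_deg0//.
by rewrite memvE (sumv_sup ord_max)// -memvE twist_deg1.
Qed.

Lemma twist_deg_act (x : g) k j u :
  u \in twist_deg j -> act (l := twist_lmod) (tmon x k) u \in twist_deg (j + k).
Proof.
move=> uj; rewrite [act _ _]/= /twist_act !tmonE.
have phi0 : phi 0 = 0.
  by have := phil (-1) 0 0; rewrite scaler0 addr0 scaleN1r addNr.
have [jr|jr] := eqVneq j r; last first.
  have [jr1|jr1] := eqVneq j r.+1; last first.
    by rewrite (twist_degN uj jr jr1) /= !linear0 addr0 mem0v.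
  move: uj; rewrite jr1 twist_deg1 => /eqP->.
  case: k => [|k]; rewrite /= ?act0l !linear0 ?addr0; last exact: mem0v.
  by rewrite addn0 twist_deg1.
move: uj; rewrite jr twist_deg0 => /eqP->.
case: k => [|[|k]] /=; rewrite ?phi0 ?act0l ?linear0 ?zero_lfunE ?addr0 ?add0r.
- by rewrite addn0 twist_deg0.
- by rewrite addn1 twist_deg1.
- exact: mem0v.
Qed.

Definition twist_gr : grModule g := GrModule twist_deg_sum twist_deg_act.

Definition twist_inl (w : W) : W * V := (w, 0).

Lemma twist_inl_linear : linear twist_inl.
Proof. by move=> k w w'; apply: injective_projections; rewrite //= scaler0 addr0. Qed.

HB.instance Definition _ := GRing.isLinear.Build K W (W * V)%type _ twist_inl twist_inl_linear.

Definition twist_inc : 'Hom(ev_gr W r.+1, twist_gr) := linfun twist_inl.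
Definition twist_prj : 'Hom(twist_gr, ev_gr V r) := linfun (snd : W * V -> V).

Lemma twist_incE w : twist_inc w = (w, 0). Proof. exact: lfunE. Qed.
Lemma twist_prjE (u : W * V) : twist_prj u = u.2. Proof. exact: lfunE. Qed.

Lemma twist_inc_hom : is_gr_hom twist_inc.
Proof.
split=> [a w|j w].
  by rewrite !twist_incE; apply: injective_projections; rewrite /= !linear0 ?addr0.
rewrite /= /ev_deg; case: eqP => [->|_]; first by rewrite twist_incE twist_deg1.
by rewrite memv0 => /eqP->; rewrite linear0 mem0v.
Qed.

Lemma twist_prj_hom : is_gr_hom twist_prj.
Proof.
split=> [a u|j u]; first by rewrite !twist_prjE.
rewrite /= /ev_deg; case: eqP => [_ _|/eqP jr]; first exact: memvf.
have [->|jr1] := eqVneq j r.+1.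
  by rewrite twist_deg1 twist_prjE memv0.
by move=> uj; rewrite (twist_degN uj jr jr1) linear0 mem0v.
Qed.

Lemma twist_inj : lker twist_inc = 0%VS.
Proof.
apply/eqP/lker0P => w w'; rewrite !twist_incE.
by case.
Qed.

Lemma twist_exact : limg twist_inc = lker twist_prj.
Proof.
apply/vspaceP => u; rewrite memv_ker twist_prjE; apply/memv_imgP/eqP.
  by case=> w _ ->; rewrite twist_incE.
by case: u => w v /= ->; exists w; rewrite ?memvf ?twist_incE.
Qed.

Lemma twist_surj : limg twist_prj = fullv.
Proof.
apply/vspaceP => v; rewrite memvf; apply/memv_imgP.
by exists (0, v); rewrite ?memvf ?twist_prjE.
Qed.

Definition twist_ext : extension (ev_gr V r) (ev_gr W r.+1) :=
  Extension twist_inc_hom twist_prj_hom twist_inj twist_exact twist_surj.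

End TwistedSum.

(** * Classes of extensions in adjacent degrees and equivariant maps *)

Section TwistedExtensions.
Variables (K : numFieldType) (g : vectLieAlgType K) (V W : lieModule g) (r : nat).
Implicit Types phi : g -> 'Hom(V, W).

Definition equivariant phi :=
  forall x y v, phi (lie x y) v = act x (phi y v) - phi y (act x v).

(** Preserving degrees forces an equivalence to be the identity on W + V; the actions of x t then
    agree. *)
Lemma twist_equiv_inj phi1 phi2 (l1 : linear phi1) (e1 : equivariant phi1)
    (l2 : linear phi2) (e2 : equivariant phi2) :
  ext_equiv (twist_ext l1 e1 r) (twist_ext l2 e2 r) -> forall x, phi1 x = phi2 x.
Proof.
case=> psi [[psi_act psi_deg] psi_inc psi_prj] x; apply/lfunP => v.
have psi_v : psi (0 : W, v) = (0, v).
  have := psi_deg r (0 : W, v); rewrite /= !twist_deg0 eqxx => /(_ isT)/eqP p1.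
  have := psi_prj (0 : W, v); rewrite /= !twist_prjE /= => p2.
  exact: injective_projections.
have psi_w w : psi (w, 0 : V) = (w, 0).
  by have := psi_inc w; rewrite /= !twist_incE.
have := psi_act (tmon x 1) (0 : W, v).
rewrite psi_v [act _ _]/= [X in _ = X -> _]/= /twist_act /= !act0l !add0r psi_w.
by case.
Qed.

Lemma twist_baer_sum phi1 phi2 phi3 (l1 : linear phi1) (e1 : equivariant phi1)
    (l2 : linear phi2) (e2 : equivariant phi2) (l3 : linear phi3) (e3 : equivariant phi3) :
  (forall x, phi3 x = phi1 x + phi2 x) ->
  is_baer_sum (twist_ext l1 e1 r) (twist_ext l2 e2 r) (twist_ext l3 e3 r).
Proof.
move=> phi12.
(* On the fibre product the V-components coincide, so keeping the first one is symmetric. *)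
have [q qE] : exists q : 'Hom(((W * V) * (W * V))%type, (W * V)%type),
    forall u, q u = (u.1.1 + u.2.1, u.1.2).
  apply: lfun_of_linear => k u v; apply: injective_projections => //=.
  by rewrite addrACA -scalerDr.
exists q; split.
- move=> a [w1 v1] [w2 v2]; rewrite /in_fibre /= !twist_prjE /= => v12.
  rewrite !qE /= /twist_act /=; apply: injective_projections => //=.
  by rewrite linearD /= phi12 add_lfunE v12 addrACA.
- move=> j [w1 v1] [w2 v2] _ /= u1 u2; rewrite qE /=.
  have [jr|jr] := eqVneq j r.
    move: u1 u2; rewrite jr !twist_deg0 /= => /eqP-> /eqP->.
    by rewrite add0r eqxx.
  have [jr1|jr1] := eqVneq j r.+1.
    by move: u1; rewrite jr1 !twist_deg1.
  have := twist_degN u1 jr jr1; have := twist_degN u2 jr jr1 => -[-> _] [-> ->].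
  by rewrite addr0 mem0v.
- by move=> b c; rewrite qE /= !twist_incE.
- by move=> [w1 v1] [w2 v2] _; rewrite qE /= !twist_prjE.
Qed.

Lemma twist_baer_scale c phi1 phi2 (l1 : linear phi1) (e1 : equivariant phi1)
    (l2 : linear phi2) (e2 : equivariant phi2) :
  (forall x, phi2 x = c *: phi1 x) ->
  is_baer_scale c (twist_ext l1 e1 r) (twist_ext l2 e2 r).
Proof.
move=> phi12.
have [q qE] : exists q : 'Hom((W * V)%type, (W * V)%type),
    forall u, q u = (c *: u.1, u.2).
  apply: lfun_of_linear => k u v; apply: injective_projections => //=.
  by rewrite scalerDr !scalerA mulrC.
exists q; split.
- split=> [a [w v]|j [w v] /= u].
    rewrite !qE /= /twist_act /=; apply: injective_projections => //=.
    by rewrite linearZ /= phi12 scale_lfunE scalerDr.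
  rewrite qE /=; have [jr|jr] := eqVneq j r.
    by move: u; rewrite jr !twist_deg0 /= => /eqP->; rewrite scaler0.
  have [jr1|jr1] := eqVneq j r.+1.
    by move: u; rewrite jr1 !twist_deg1.
  by have [-> ->] := twist_degN u jr jr1; rewrite scaler0 mem0v.
- by move=> b; rewrite qE /= !twist_incE.
- by move=> [w v]; rewrite qE /= !twist_prjE.
Qed.

(** Only the t^1 piece survives, and the cocycle rule on x and y t becomes equivariance because c(x)
    = 0. *)
Lemma adjacent_cocycle (E : extension (ev_gr V r) (ev_gr W r.+1)) (sigma : 'Hom(V, E)) :
  (forall v, ext_prj E (sigma v) = v) -> (forall v, sigma v \in deg E r) ->
  exists c : current g -> 'Hom(V, W),
    [/\ forall a v, ext_inc E (c a v) = act a (sigma v) - sigma (ev_act a v),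
        linear (fun x : g => c (tmon x 1)),
        equivariant (fun x : g => c (tmon x 1)) &
        forall x k, k != 1%N -> c (tmon x k) = 0].
Proof.
move=> ps sd; have [c [icE cl cc c0]] := ext_cocycle ps sd.
have ck x k : k != 1%N -> c (tmon x k) = 0.
  by move=> k1; apply: c0; rewrite -[r.+1]addn1 eqn_add2l.
exists c; split=> // [a x y|x y v]; first by rewrite tmon_linear cl.
have -> : tmon (lie x y) 1 = lie (tmon x 0) (tmon y 1) by rewrite lie_tmon.
by rewrite cc (ck x 0%N)// !zero_lfunE /ev_act linear0 subr0 sub0r.
Qed.

Lemma twist_equiv_surj (E : extension (ev_gr V r) (ev_gr W r.+1)) :
  exists phi (l : linear phi) (e : equivariant phi), ext_equiv E (twist_ext l e r).
Proof.
have [sigma [ps sd]] := ext_section E.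
have [c [icE l e ck]] := adjacent_cocycle ps sd.
set phi := (fun x => _) in l e.
exists phi, l, e.
set i := ext_inc E in icE *; set p := ext_prj E in ps *.
have [psi psiE] : exists psi : 'Hom(E, (W * V)%type),
    forall u, psi u = ((i^-1)%VF (u - sigma (p u)), p u).
  apply: lfun_of_linear => k u v; apply: injective_projections => /=; last exact: linearP.
  by rewrite (linearP p) (linearP sigma) /= opprD addrACA -scalerBr linearP.
(* [psi] reads off the decomposition of E as i(W) + sigma(V). *)
have psi_sum w v : psi (i w + sigma v) = (w, v).
  have pE : p (i w + sigma v) = v.
    by rewrite linearD /= ps (ext_prj_inc E w : p (i w) = 0) add0r.
  by rewrite psiE pE addrK [(i^-1)%VF _]ext_incK.
have dec u : exists w, exists v, u = i w + sigma v.
  exists ((i^-1)%VF (u - sigma (p u))), (p u); rewrite ext_incVK ?subrK//.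
  by rewrite linearB /= ps subrr.
exists psi; split.
- split.
    apply: lmod_hom_tmon => x k u; have [w [v ->]] := dec u.
    have iact a (w' : W) : act a (i w' : E) = i (ev_act a w') by rewrite (ext_inc_hom E).1.
    have sact a v' : act a (sigma v') = i (c a v') + sigma (ev_act a v').
      by rewrite icE subrK.
    rewrite linearD /= iact sact addrA -linearD /= !psi_sum.
    apply: injective_projections => //=; congr (_ + _).
    have phi0 : phi 0 = 0 by have := l (-1) 0 0; rewrite scaler0 addr0 scaleN1r addNr.
    by case: k => [|[|k]] //=; rewrite ck// phi0.
  move=> j u uj; have [jr|jr] := eqVneq j r.
    move: uj; rewrite jr => ur; rewrite /= twist_deg0 psiE /= (_ : u - sigma (p u) = 0) ?linear0//.
    apply: (@deg_disjoint _ _ E r r.+1); first by apply: memvB.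
      rewrite -[u - _](@ext_incVK _ _ _ _ _ _ E) ?ext_inc_deg//.
      by rewrite linearB /= ps subrr.
    by rewrite ltn_eqF.
  have pu : p u = 0 by apply: (ext_prj_deg uj).
  have [jr1|jr1] := eqVneq j r.+1; first by rewrite jr1 /= twist_deg1 psiE pu.
  have -> : u = 0; last by rewrite linear0 mem0v.
  apply: (@deg_disjoint _ _ E j r.+1) => //.
  by rewrite -[u](@ext_incVK _ _ _ _ _ _ E) ?ext_inc_deg.
- by move=> b; rewrite -[ext_inc E b]addr0 -(linear0 sigma) psi_sum /= twist_incE.
- by move=> u; rewrite /= twist_prjE psiE.
Qed.

End TwistedExtensions.

(** * Moving g across by the Killing form *)

Section KillingContraction.
Variables (C : numClosedFieldType) (g : vectLieAlgType C).
Hypothesis g_simple : lie_simple g.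
Variable d : g.
Hypothesis d_ss : real_semisimple d.
Variables V W : lieModule g.

Local Notation ad := (act_mx (adjoint g)).
Definition killing_gram : 'M[C]_(dim g) := trace_gram ad.

Lemma killing_gram_unit : killing_gram \in unitmx.
Proof.
apply: (trace_gram_unit g_simple d_ss (act_mx_rep (adjoint g))).
have [[x [y xy]] _] := g_simple; exists x; apply: contra xy => /eqP ax.
have := act_mxE x (y : adjoint g); rewrite ax mulmx0 => /(congr1 r2v).
by rewrite v2rK linear0 => /esym/eqP.
Qed.

Lemma killing_gram_inv x : ad x *m killing_gram = - (killing_gram *m (ad x)^T).
Proof.
apply/matrixP => i j.
have E (u v : 'rV[C]_(dim g)) :
    (u *m (ad x *m killing_gram) *m v^T) 0 0 = - (u *m (killing_gram *m (ad x)^T) *m v^T) 0 0.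
  have := trace_form_inv (act_mx_rep (adjoint g)) x (r2v u) (r2v v).
  rewrite !(trace_gramE (act_mx_rep (adjoint g))) -/killing_gram.
  have lieE (w : 'rV[C]_(dim g)) : v2r (lie x (r2v w)) = w *m ad x.
    by rewrite -[w in RHS](r2vK (vT := g)) (act_mxE x (r2v w : adjoint g)).
  by rewrite !lieE !r2vK trmx_mul !mulmxA.
have := E (delta_mx 0 i) (delta_mx 0 j).
by rewrite !trmx_delta -!rowE -!colE !mxE.
Qed.

(** Contraction of the g factor with x by the Killing form: y (x) w goes to kappa(x, y) w. *)
Definition contract (M : 'M[C]_(dim g, dim W)) (x : g) : W :=
  r2v (v2r x *m killing_gram *m M).

Lemma contract_exists (f : lieHom V (tensor (adjoint g) W)) :
  exists phi : g -> 'Hom(V, W),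
    [/\ linear phi, equivariant phi & forall x v, phi x v = contract (f v) x].
Proof.
have H x : exists F : 'Hom(V, W), forall v, F v = contract (f v) x.
  by apply: lfun_of_linear => k u v; rewrite /contract linearP /= mulmxDr -scalemxAr linearP.
have [phi phiE] := choice H; exists phi; split=> //.
  move=> k x y; apply/lfunP => v; rewrite add_lfunE scale_lfunE !phiE /contract.
  by rewrite linearP !mulmxDl -!scalemxAl linearP.
move=> x y v; rewrite !phiE /contract; have /asboolP fP := lieHomP f.
rewrite fP [act x (f v)]/= /tensor_act -(act_mxE x (y : adjoint g)).
rewrite -[v2r y *m ad x *m _]mulmxA killing_gram_inv.
apply: v2r_inj; rewrite linearB /= -[v2r (act x _)]act_mxE !r2vK.
by rewrite mulmxDr !mulmxN !mulmxA mulNmx opprD addrCA subrr addr0.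
Qed.

Lemma contract_inj (M N : 'M[C]_(dim g, dim W)) :
  (forall x, contract M x = contract N x) -> M = N.
Proof.
move=> MN; suff E : killing_gram *m M = killing_gram *m N.
  by rewrite -[M](mulKmx killing_gram_unit) E mulKmx// killing_gram_unit.
apply/row_matrixP => i; rewrite !rowE -[delta_mx 0 i](r2vK (vT := g)) !mulmxA.
exact/(can_inj r2vK)/MN.
Qed.

Lemma contract_surj (phi : g -> 'Hom(V, W)) : linear phi -> equivariant phi ->
  exists f : lieHom V (tensor (adjoint g) W), forall x v, phi x v = contract (f v) x.
Proof.
move=> phil phiE; have Ku := killing_gram_unit.
pose M v := \matrix_i v2r (phi (std_basis i) v).
have ME x v : v2r x *m M v = v2r (phi x v).
  have [Phi PhiE] := lfun_of_linear phil.
  rewrite -PhiE {2}(std_basis_sum x) linear_sum sum_lfunE linear_sum mulmx_sum_row.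
  by apply: eq_bigr => i _; rewrite linearZ /= scale_lfunE linearZ /= PhiE rowK.
have [F FE] : exists F : 'Hom(V, tensor (adjoint g) W), forall v, F v = invmx killing_gram *m M v.
  apply: lfun_of_linear => k u v; rewrite scalemxAr -mulmxDr; congr (_ *m _).
  by apply/row_matrixP => i; rewrite linearP /= !rowK !linearP.
have Mact x v : M (act x v) = M v *m act_mx W x - ad x *m M v.
  apply/row_matrixP => i; rewrite linearB /= !row_mul !rowK.
  have -> : row i (ad x) = v2r (lie x (std_basis i) : g).
    by rewrite rowE -(act_mxE x (std_basis i : adjoint g)) /std_basis r2vK.
  by rewrite ME act_mxE -linearB /= phiE opprB addrC subrK.
have Fhom : is_lmod_hom F.
  move=> x v; rewrite [act x (F v)]/= !FE /tensor_act Mact mulmxBr !mulmxA.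
  rewrite addrC; congr (_ + _); rewrite -mulNmx; congr (_ *m _).
  rewrite -[ad x in LHS](mulmxK Ku) killing_gram_inv !mulNmx mulmxN opprK.
  by rewrite -!mulmxA mulKmx.
exists (LieHom (introT (asboolP _) Fhom)) => x v /=.
by rewrite /contract FE mulmxA mulmxK// ME v2rK.
Qed.

Theorem ext1_adjacent r :
  Ext1_iso (ev_gr V r) (ev_gr W r.+1) (lieHom V (tensor (adjoint g) W)).
Proof.
have [phi phiP] := choice contract_exists.
have phil f : linear (phi f) by have [] := phiP f.
have phie f : equivariant (phi f) by have [] := phiP f.
have phiE f x v : phi f x v = contract (f v) x by have [] := phiP f.
exists (fun f => twist_ext (phil f) (phie f) r); split.
- move=> u v /twist_equiv_inj uv; apply: val_inj; apply/lfunP => w /=.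
  by apply: contract_inj => x; rewrite -!phiE uv.
- move=> E; have [psi [pl [pe Eequiv]]] := twist_equiv_surj E.
  have [f fE] := contract_surj pl pe; exists f.
  (* [twist_ext] takes proofs as arguments, so [psi] and [phi f] must be identified as functions,
     and their proofs by proof irrelevance. *)
  have pphi : psi = phi f by apply/funext => x; apply/lfunP => v; rewrite fE phiE.
  move: pl pe Eequiv; rewrite pphi => pl pe.
  by rewrite (Prop_irrelevance pl (phil f)) (Prop_irrelevance pe (phie f)).
- move=> u v; apply: twist_baer_sum => x; apply/lfunP => w.
  by rewrite add_lfunE !phiE /contract /= add_lfunE mulmxDr linearD.
- move=> c u; apply: twist_baer_scale => x; apply/lfunP => w.
  by rewrite scale_lfunE !phiE /contract /= scale_lfunE -scalemxAr linearZ.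
Qed.

End KillingContraction.

(** * Pairs that do not cover *)

Section NotCovering.
Variables (C : numClosedFieldType) (g : vectLieAlgType C).
Hypothesis g_simple : lie_simple g.
Variable h : {vspace g}.
Hypothesis h_cartan : cartan_subalgebra h.
Variable D : seq (weight h).
Hypothesis D_base : is_root_base D.
Variables (V W : lieModule g) (l m : weight h).
Hypotheses (V_hw : is_simple_hw D l V) (W_hw : is_simple_hw D m W).

Lemma ext1_not_covering r s :
  ~ covers (m, s) (l, r) -> Ext1_zero (ev_gr V r) (ev_gr W s).
Proof.
have [d dP] := exists_level_element D_base.
have d_ss := level_element_semisimple h_cartan D_base dP g_simple.
move=> ncov; have [sr|sr1] := pselect (s = r.+1); last exact: (ext1_nonadjacent g_simple d_ss).
move: ncov; rewrite sr => ncov E; have [sigma [ps sd]] := ext_section E.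
have [c [icE cl ce ck]] := adjacent_cocycle ps sd.
have c1 x : c (tmon x 1) = 0.
  apply: (weight_equivariant_eq0 h_cartan D_base dP V_hw W_hw cl ce) => cov.
  exact: ncov.
apply: (ext_split_tmon ps sd) => x k v; apply/eqP; rewrite -subr_eq0 -icE.
by have [->|/ck->] := eqVneq k 1%N; rewrite ?c1 zero_lfunE linear0.
Qed.

End NotCovering.

Theorem proposition2p5 (R : realType) (g : vectLieAlgType R[i])
    (g_simple : lie_simple g)
    (h : {vspace g}) (h_cartan : cartan_subalgebra h)
    (D : seq (weight h)) (D_base : is_root_base D)
    (lambda mu : weight h)
    (lambda_dom : dominant_integral D lambda) (mu_dom : dominant_integral D mu)
    (Vlambda Vmu : lieModule g)
    (Vlambda_hw : is_simple_hw D lambda Vlambda)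
    (Vmu_hw : is_simple_hw D mu Vmu)
    (r s : nat) :
  [/\ s <> r.+1 -> Ext1_zero (ev_gr Vlambda r) (ev_gr Vmu s),
      Ext1_iso (ev_gr Vlambda r) (ev_gr Vmu r.+1)
        (lieHom Vlambda (tensor (adjoint g) Vmu)) &
      ~ covers (mu, s) (lambda, r) ->
        Ext1_zero (ev_gr Vlambda r) (ev_gr Vmu s)].
Proof.
have [d dP] := exists_level_element D_base.
have d_ss := level_element_semisimple h_cartan D_base dP g_simple.
split.
- exact: (ext1_nonadjacent g_simple d_ss).
- exact: (ext1_adjacent g_simple d_ss).
- exact: (ext1_not_covering g_simple h_cartan D_base Vlambda_hw Vmu_hw).
Qed.
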